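(* Let $(G,K)$ be a Gelfand pair with $G$ compact, let $\gamma\colon\mathcal{S}^+\to[0,\infty)$ be measurable, let $\alpha>s>0$ and put $p:=\frac{2\alpha}{\alpha+s}$, with Hölder conjugate $p'=\frac{p}{p-1}$. Suppose $(1+\gamma^2)^{-1}\in L^{\alpha}(\mathcal{S}^+,\widehat\mu)$ and $$\lim_{y\to e}\ \sup_{\phi\in\mathcal{S}^+}\frac{|\phi(y)-1|}{(1+\gamma(\phi)^2)^{s/2}}=0.$$ Then for every $q\in[1,p']$, $H^s_\gamma(K\backslash G/K)$ is compactly embedded in $L^q(K\backslash G/K)$, i.e. it is continuously embedded and the inclusion maps bounded subsets of $H^s_\gamma(K\backslash G/K)$ to relatively compact subsets of $L^q(K\backslash G/K)$.
   Context: $G$ is a compact Hausdorff group with normalized Haar measure $dx$ and identity $e$, and $K$ is a closed subgroup of $G$ with normalized Haar measure $dk$. Functions on the double coset space $K\backslash G/K$ are identified with bi-$K$-invariant functions on $G$ (i.e. $f(k_1xk_2)=f(x)$ for all $k_1,k_2\in K$, $x\in G$); thus $L^p(K\backslash G/K)$ is the space of bi-$K$-invariant functions in $L^p(G)$. Convolution is $f\star g(x)=\int_G f(xy^{-1})g(y)\,dy$. $(G,K)$ is a Gelfand pair if $L^1(K\backslash G/K)$ is a commutative algebra under convolution. A spherical function is a nonzero continuous function $\phi\colon G\to\mathbb{C}$ with $\int_K\phi(xky)\,dk=\phi(x)\phi(y)$ for all $x,y\in G$. A function $\phi$ is positive-semidefinite if $\sum_{n,m=1}^N\phi(x_n^{-1}x_m)\overline{z_n}z_m\geq0$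 for all $N$, $x_1,\dots,x_N\in G$, $z_1,\dots,z_N\in\mathbb{C}$. $\mathcal{S}^+$ denotes the set of positive-semidefinite spherical functions, with the topology of uniform convergence on $G$. The spherical transform of $f\in L^1(K\backslash G/K)$ is $\widehat f(\phi)=\int_G f(x)\phi(x^{-1})\,dx$, $\phi\in\mathcal{S}^+$. $\widehat\mu$ denotes the Plancherel measure on $\mathcal{S}^+$: the measure for which the spherical transform, restricted to $L^1\cap L^2(K\backslash G/K)$, is isometric into $L^2(\mathcal{S}^+,\widehat\mu)$ and extends to an isometric isomorphism $L^2(K\backslash G/K)\to L^2(\mathcal{S}^+,\widehat\mu)$ (still denoted $f\mapsto\widehat f$). For a measurable $\gamma\colon\mathcal{S}^+\to[0,\infty)$ and $s\geq0$, the Sobolev space is $H^s_{\gamma}(K\backslash G/K)=\{f\in L^2(K\backslash G/K): \int_{\mathcal{S}^+}(1+\gamma(\phi)^2)^s|\widehat f(\phi)|^2\,d\widehat\mu(\phi)<\infty\}$ with norm $\|f\|_{H^s_\gamma}=\big(\int_{\mathcal{S}^+}(1+\gamma(\phi)^2)^s|\widehat f(\phi)|^2\,d\widehat\mu(\phi)\big)^{1/2}$. *)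

(* Defs.v *)
From HB Require Import structures.
From mathcomp Require Import all_boot all_order all_algebra.
From mathcomp Require Import all_classical all_reals all_analysis.
From mathcomp Require Import complex.
Set Implicit Arguments. Unset Strict Implicit. Unset Printing Implicit Defensive.
Import Order.TTheory GRing.Theory Num.Theory.
Import numFieldNormedType.Exports.
Local Open Scope classical_set_scope.
Local Open Scope ring_scope.

(* complex numbers are pointed (by 0), so that function spaces into them are *)
HB.instance Definition _ (R : rcfType) := isPointed.Build R[i] 0.

Definition cabs (R : realType) (z : R[i]) : R := ComplexField.Normc.normc z.

Definition cint (R : realType) d (T : measurableType d)
  (mu : {measure set T -> \bar R}) (D : set T) (f : T -> R[i]) : R[i] :=
  Complex (Rintegral mu D (fun x => complex.Re (f x))) (Rintegral mu D (fun x => complex.Im (f x))).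

Definition in_Lp (R : realType) d (T : measurableType d)
  (mu : {measure set T -> \bar R}) (D : set T) (p : R) (f : T -> R[i]) : Prop :=
  [/\ measurable_fun D (fun x => complex.Re (f x)),
      measurable_fun D (fun x => complex.Im (f x)) &
      (\int[mu]_(x in D) ((cabs (f x)) `^ p)%:E < +oo)%E].

Definition Lp_norm (R : realType) d (T : measurableType d)
  (mu : {measure set T -> \bar R}) (D : set T) (p : R) (f : T -> R[i]) : R :=
  (Rintegral mu D (fun x => (cabs (f x)) `^ p)) `^ p^-1.

Definition is_compact_group (G : ptopologicalType)
  (mul : G -> G -> G) (inv : G -> G) (e : G) : Prop :=
  [/\ hausdorff_space G, compact [set: G],
      (forall x y z, mul x (mul y z) = mul (mul x y) z),
      (forall x, mul e x = x /\ mul x e = x) &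
      (forall x, mul (inv x) x = e /\ mul x (inv x) = e)] /\
  (continuous (fun z : G * G => mul z.1 z.2) /\ continuous inv).

Definition Gborel (G : ptopologicalType) := g_sigma_algebraType (@open G).

Definition radon (R : realType) (G : ptopologicalType)
  (nu : {measure set Gborel G -> \bar R}) : Prop :=
  (forall A : set (Gborel G), measurable A ->
     nu A = ereal_inf [set nu U | U in [set U : set (Gborel G) |
                                         @open G U /\ A `<=` U]]) /\
  (forall U : set (Gborel G), @open G U ->
     nu U = ereal_sup [set nu C | C in [set C : set (Gborel G) |
                                         @compact G C /\ C `<=` U]]).

Definition is_haar (R : realType) (G : ptopologicalType) (mul : G -> G -> G)
  (mu : {measure set Gborel G -> \bar R}) : Prop :=
  [/\ mu setT = 1%E,
      (forall (x : G) (A : set (Gborel G)), measurable A ->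
         mu [set mul x y | y in A] = mu A) &
      radon mu].

Definition closed_subgroup (G : ptopologicalType)
  (mul : G -> G -> G) (inv : G -> G) (e : G) (K : set G) : Prop :=
  [/\ closed K, K e, (forall x y, K x -> K y -> K (mul x y)) &
      (forall x, K x -> K (inv x))].

(* normalized Haar measure dk of the closed subgroup K, viewed as a Borel
   measure on G carried by K *)
Definition is_haar_sub (R : realType) (G : ptopologicalType)
  (mul : G -> G -> G) (K : set G) (nu : {measure set Gborel G -> \bar R}) : Prop :=
  [/\ nu setT = 1%E, nu (~` K) = 0%E,
      (forall (k : G) (A : set (Gborel G)), K k -> measurable A ->
         nu [set mul k y | y in A] = nu A) &
      radon nu].

Definition biK (R : realType) (G : ptopologicalType) (mul : G -> G -> G)
  (K : set G) (f : G -> R[i]) : Prop :=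
  forall k1 k2 x, K k1 -> K k2 -> f (mul (mul k1 x) k2) = f x.

Definition conv (R : realType) (G : ptopologicalType) (mul : G -> G -> G)
  (inv : G -> G) (mu : {measure set Gborel G -> \bar R}) (f g : G -> R[i])
  (x : G) : R[i] :=
  cint mu setT (fun y : Gborel G => f (mul x (inv y)) * g y).

(* (G,K) is a Gelfand pair: L^1(K\G/K) is commutative under convolution
   (convolutions being compared as elements of L^1, i.e. a.e.) *)
Definition gelfand_pair (R : realType) (G : ptopologicalType)
  (mul : G -> G -> G) (inv : G -> G) (K : set G)
  (mu : {measure set Gborel G -> \bar R}) : Prop :=
  forall f g : G -> R[i], biK mul K f -> biK mul K g ->
    in_Lp mu setT 1 f -> in_Lp mu setT 1 g ->
    {ae mu, forall x, conv mul inv mu f g x = conv mul inv mu g f x}.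

Definition ccontinuous (R : realType) (G : ptopologicalType) (phi : G -> R[i])
  : Prop :=
  forall (x : G) (eps : R), 0 < eps -> \forall y \near x, cabs (phi y - phi x) < eps.

Definition spherical (R : realType) (G : ptopologicalType) (mul : G -> G -> G)
  (nu : {measure set Gborel G -> \bar R}) (phi : G -> R[i]) : Prop :=
  [/\ (exists x, phi x != 0), ccontinuous phi &
      forall x y, cint nu setT (fun k : Gborel G => phi (mul (mul x k) y))
                  = phi x * phi y].

Definition pos_semidef (R : realType) (G : ptopologicalType)
  (mul : G -> G -> G) (inv : G -> G) (phi : G -> R[i]) : Prop :=
  forall (N : nat) (xs : 'I_N -> G) (zs : 'I_N -> R[i]),
    0 <= \sum_(n < N) \sum_(m < N)
           phi (mul (inv (xs n)) (xs m)) * conjc (zs n) * zs m.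

Definition Splus (R : realType) (G : ptopologicalType) (mul : G -> G -> G)
  (inv : G -> G) (nu : {measure set Gborel G -> \bar R}) : set (G -> R[i]) :=
  [set phi | spherical mul nu phi /\ pos_semidef mul inv phi].

Definition splus_open (R : realType) (G : ptopologicalType) (mul : G -> G -> G)
  (inv : G -> G) (nu : {measure set Gborel G -> \bar R})
  (U : set (G -> R[i])) : Prop :=
  U `<=` Splus mul inv nu /\
  forall phi, U phi -> exists eps : R, 0 < eps /\
    forall psi, Splus mul inv nu psi ->
      (forall x, cabs (psi x - phi x) < eps) -> U psi.

(* measurable space whose sigma-algebra is generated by the open subsets of
   S^+; its trace on S^+ is the Borel sigma-algebra of S^+ *)
Definition Smeas (R : realType) (G : ptopologicalType) (mul : G -> G -> G)
  (inv : G -> G) (nu : {measure set Gborel G -> \bar R}) :=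
  g_sigma_algebraType (splus_open mul inv nu).

Definition sph_transform (R : realType) (G : ptopologicalType)
  (inv : G -> G) (mu : {measure set Gborel G -> \bar R}) (f : G -> R[i])
  (phi : G -> R[i]) : R[i] :=
  cint mu setT (fun x : Gborel G => f x * phi (inv x)).

(* muh is the Plancherel measure on S^+ and F is the L^2-extension of the
   spherical transform *)
Definition is_plancherel (R : realType) (G : ptopologicalType)
  (mul : G -> G -> G) (inv : G -> G) (K : set G)
  (mu nu : {measure set Gborel G -> \bar R})
  (muh : {measure set Smeas mul inv nu -> \bar R})
  (F : (G -> R[i]) -> Smeas mul inv nu -> R[i]) : Prop :=
  let S : set (Smeas mul inv nu) := Splus mul inv nu in
  muh (~` S) = 0%E /\
  [/\
      (forall f, biK mul K f -> in_Lp mu setT 1 f -> in_Lp mu setT 2 f ->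
         in_Lp muh S 2 (sph_transform inv mu f) /\
         Lp_norm muh S 2 (sph_transform inv mu f) = Lp_norm mu setT 2 f),
      (forall f, biK mul K f -> in_Lp mu setT 1 f -> in_Lp mu setT 2 f ->
         {ae muh, forall phi, S phi -> F f phi = sph_transform inv mu f phi}),
      (forall f, biK mul K f -> in_Lp mu setT 2 f ->
         in_Lp muh S 2 (F f) /\ Lp_norm muh S 2 (F f) = Lp_norm mu setT 2 f),
      (forall (a : R[i]) f g, biK mul K f -> biK mul K g ->
         in_Lp mu setT 2 f -> in_Lp mu setT 2 g ->
         {ae muh, forall phi, S phi ->
            F (fun x => a * f x + g x) phi = a * F f phi + F g phi}) &
      (forall h : Smeas mul inv nu -> R[i], in_Lp muh S 2 h ->
         exists f, [/\ biK mul K f, in_Lp mu setT 2 f &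
                       {ae muh, forall phi, S phi -> F f phi = h phi}])].

Definition in_Hs (R : realType) (G : ptopologicalType)
  (mul : G -> G -> G) (inv : G -> G) (K : set G)
  (mu nu : {measure set Gborel G -> \bar R})
  (muh : {measure set Smeas mul inv nu -> \bar R})
  (F : (G -> R[i]) -> Smeas mul inv nu -> R[i])
  (gamma : Smeas mul inv nu -> R) (s : R) (f : G -> R[i]) : Prop :=
  [/\ biK mul K f, in_Lp mu setT 2 f &
      (\int[muh]_(phi in (Splus mul inv nu : set (Smeas mul inv nu)))
         (((1 + gamma phi ^+ 2) `^ s) * (cabs (F f phi)) ^+ 2)%:E < +oo)%E].

Definition Hs_norm (R : realType) (G : ptopologicalType)
  (mul : G -> G -> G) (inv : G -> G)
  (nu : {measure set Gborel G -> \bar R})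
  (muh : {measure set Smeas mul inv nu -> \bar R})
  (F : (G -> R[i]) -> Smeas mul inv nu -> R[i])
  (gamma : Smeas mul inv nu -> R) (s : R) (f : G -> R[i]) : R :=
  (Rintegral muh (Splus mul inv nu)
     (fun phi => ((1 + gamma phi ^+ 2) `^ s) * (cabs (F f phi)) ^+ 2)) `^ (2^-1).

Definition exp_p (R : realType) (alpha s : R) : R := 2 * alpha / (alpha + s).
Definition exp_p' (R : realType) (alpha s : R) : R :=
  exp_p alpha s / (exp_p alpha s - 1).

(* Main.v *)
Require Import Defs.
From HB Require Import structures.
From mathcomp Require Import all_boot all_order all_algebra.
From mathcomp Require Import all_classical all_reals all_analysis.
From mathcomp Require Import measurable_realfun complex ring lra.
Import Order.TTheory GRing.Theory Num.Theory.
Import numFieldNormedType.Exports.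
Local Open Scope classical_set_scope.
Local Open Scope ring_scope.
Set Implicit Arguments.
Unset Strict Implicit.

(* Write w = 1 + gamma^2 and p' = 2 alpha / (alpha - s). The growth hypothesis at
   y = e gives phi(e) = 1, so positive-semidefinite spherical functions are
   bounded, and by duality in the Plancherel isometry a function whose transform
   is integrable is essentially bounded by a multiple of the integral.

   Embedding into L^p': for each level lambda cut the transform at the frequency
   where the low part is bounded by lambda / 2, control the high part in L^2,
   and sum over dyadic levels (the argument of Chemin and Xu); since the Haar
   measure is finite, q < p' follows. The constant tends to 0 with the integral
   of w^(- alpha).

   Compactness: a transform equal to the indicator of E comes from a bounded
   function, whence the Plancherel measure of E is 0 or at least 1/16. So {w <= j}
   splits into finitely many atoms, bounded sequences of transforms converge
   along a subsequence uniformly on each {w <= j}, and the embedding applied to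
   u_n - g with w multiplied by a large constant on {w <= j} shows that the
   norms tend to 0, including for q = p'. *)

(** The endpoint q = p' shapes the compactness argument. Convergence in L^2 and the embedding bound
    would give q < p' by interpolation, but not q = p', and a bound on the integrals of w^s |F
    u_n|^2 does not make their tails uniformly small. Smallness has to come from the other factor:
    up to a constant the embedding bound is N B^(s / (2 alpha)), where N^2 bounds the weighted
    energy and B the integral of w^(- alpha). The high-frequency part of B does not depend on n, so
    it is small once and for all after a suitable cut, and only the low frequencies need a new
    weight.

    The transform enters through linearity, isometry, surjectivity and a bound by the L^1 norm.
    Isometry is an equality of norms, so duality is obtained by comparing the norms of a function,
    of a test function and of their sum. The gap in the values of the Plancherel measure stands in
    for the discreteness of the dual of a compact group. *)

(** * Modulus of complex numbers *)

Section ComplexModulus.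
Context {R : realType}.
Implicit Types z : R[i].

Lemma cabs_sqrE z : cabs z ^+ 2 = complex.Re z ^+ 2 + complex.Im z ^+ 2.
Proof. by case: z => a b; rewrite /cabs /= sqr_sqrtr// addr_ge0// sqr_ge0. Qed.

Lemma cabs_ge0 z : 0 <= cabs z.
Proof. by case: z => a b; rewrite /cabs /= sqrtr_ge0. Qed.

Lemma cabsE z : cabs z = Num.sqrt (complex.Re z ^+ 2 + complex.Im z ^+ 2).
Proof. by case: z. Qed.

Lemma cabs0 : cabs (0 : R[i]) = 0.
Proof. exact: ComplexField.Normc.normc0. Qed.

Lemma cabsN1 : cabs (-1 : R[i]) = 1.
Proof. by rewrite cabsE /= oppr0 expr0n addr0 sqrrN expr1n sqrtr1. Qed.

Lemma cabsM z z' : cabs (z * z') = cabs z * cabs z'.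
Proof. exact: ComplexField.Normc.normcM. Qed.

Lemma cabsD z z' : cabs (z + z') <= cabs z + cabs z'.
Proof. exact: le_normcD. Qed.

Lemma cabs_real (r : R) : 0 <= r -> cabs (r%:C)%C = r.
Proof. by move=> r0; rewrite cabsE /= expr0n addr0 sqrtr_sqr ger0_norm. Qed.

Lemma normRe_le_cabs z : `|complex.Re z| <= cabs z.
Proof. by rewrite cabsE -sqrtr_sqr ler_sqrt ?addr_ge0 ?sqr_ge0// lerDl sqr_ge0. Qed.

Lemma normIm_le_cabs z : `|complex.Im z| <= cabs z.
Proof. by rewrite cabsE -sqrtr_sqr ler_sqrt ?addr_ge0 ?sqr_ge0// lerDr sqr_ge0. Qed.

Lemma cabs_le_normReIm z : cabs z <= `|complex.Re z| + `|complex.Im z|.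
Proof.
rewrite -(@ler_pXn2r _ 2)// ?nnegrE ?cabs_ge0 ?addr_ge0//.
rewrite cabs_sqrE -[complex.Re z ^+ 2]real_normK ?num_real//.
rewrite -[complex.Im z ^+ 2]real_normK ?num_real//.
have := mulr_ge0 (normr_ge0 (complex.Re z)) (normr_ge0 (complex.Im z)); lra.
Qed.

Lemma cabs_eq0 z : cabs z = 0 -> z = 0.
Proof. exact: ComplexField.Normc.eq0_normc. Qed.

Lemma complexReD z z' : complex.Re (z + z') = complex.Re z + complex.Re z'.
Proof. by case: z; case: z'. Qed.

Lemma complexImD z z' : complex.Im (z + z') = complex.Im z + complex.Im z'.
Proof. by case: z; case: z'. Qed.

Lemma complexReM z z' : complex.Re (z * z') =
  complex.Re z * complex.Re z' - complex.Im z * complex.Im z'.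
Proof. by case: z; case: z'. Qed.

Lemma complexImM z z' : complex.Im (z * z') =
  complex.Re z * complex.Im z' + complex.Im z * complex.Re z'.
Proof. by case: z; case: z'. Qed.

Lemma measurable_cabs d (T : measurableType d) (D : set T) (f : T -> R[i]) :
  measurable_fun D (fun x => complex.Re (f x)) ->
  measurable_fun D (fun x => complex.Im (f x)) ->
  measurable_fun D (fun x => cabs (f x)).
Proof.
move=> mr mi; under eq_fun do rewrite cabsE.
apply: (@measurableT_comp _ _ _ _ _ _ (@Num.sqrt R)).
  by apply: continuous_measurable_fun; exact: sqrt_continuous.
by apply: measurable_funD; apply: measurable_funX.
Qed.

End ComplexModulus.

(** * Integrals of nonnegative real functions *)

Section IntegralOfNonnegRealFunctions.
Context d {T : measurableType d} {R : realType} (mu : {measure set T -> \bar R}).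
Context {D : set T} (mD : measurable D).
Implicit Types f g : T -> R.

Lemma ae_le_integral_EFin f g :
  measurable_fun D f -> measurable_fun D g ->
  (forall x, D x -> 0 <= f x) -> (forall x, D x -> 0 <= g x) ->
  {ae mu, forall x, D x -> f x <= g x} ->
  (\int[mu]_(x in D) (f x)%:E <= \int[mu]_(x in D) (g x)%:E)%E.
Proof.
move=> mf mg f0 g0 fg; apply: ae_ge0_le_integral => //.
- exact/measurable_EFinP.
- exact/measurable_EFinP.
Qed.

Lemma le_integral_EFin f g :
  measurable_fun D f -> measurable_fun D g ->
  (forall x, D x -> 0 <= f x) ->
  (forall x, D x -> f x <= g x) ->
  (\int[mu]_(x in D) (f x)%:E <= \int[mu]_(x in D) (g x)%:E)%E.
Proof.
move=> mf mg f0 fg; apply: ae_le_integral_EFin => //; last exact: aeW.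
by move=> x Dx; exact: le_trans (f0 x Dx) (fg x Dx).
Qed.

Lemma integral_EFinD f g :
  measurable_fun D f -> measurable_fun D g ->
  (forall x, D x -> 0 <= f x) -> (forall x, D x -> 0 <= g x) ->
  (\int[mu]_(x in D) (f x + g x)%:E =
   \int[mu]_(x in D) (f x)%:E + \int[mu]_(x in D) (g x)%:E)%E.
Proof.
move=> mf mg f0 g0; under eq_integral do rewrite EFinD.
by rewrite ge0_integralD//; try exact/measurable_EFinP.
Qed.

Lemma integral_EFinZ k f : 0 <= k ->
  measurable_fun D f -> (forall x, D x -> 0 <= f x) ->
  (\int[mu]_(x in D) (k * f x)%:E = k%:E * \int[mu]_(x in D) (f x)%:E)%E.
Proof.
move=> k0 mf f0; under eq_integral do rewrite EFinM.
by rewrite ge0_integralZl_EFin//; exact/measurable_EFinP.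
Qed.

Lemma ae_eq_integral_EFin f g :
  measurable_fun D f -> measurable_fun D g ->
  (forall x, D x -> 0 <= f x) -> (forall x, D x -> 0 <= g x) ->
  {ae mu, forall x, D x -> f x = g x} ->
  (\int[mu]_(x in D) (f x)%:E = \int[mu]_(x in D) (g x)%:E)%E.
Proof.
move=> mf mg f0 g0 fg; apply: ge0_ae_eq_integral => //.
- exact/measurable_EFinP.
- exact/measurable_EFinP.
- by move: fg; apply: filterS => x fgx Dx; rewrite fgx.
Qed.

Lemma integral_if (b : T -> bool) f :
  (\int[mu]_(x in D) (if b x then f x else 0)%:E =
   \int[mu]_(x in D `&` [set x | b x]) (f x)%:E)%E.
Proof.
rewrite integral_mkcondr; apply: eq_integral => x Dx.
by rewrite patchE; case: ifPn => bx; [rewrite mem_set|rewrite memNset//; apply/negP].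

Qed.

Lemma measurable_fun_guard (b : T -> bool) f : measurable_fun D b ->
  measurable_fun D f -> measurable_fun D (fun x => if b x then f x else 0).
Proof.
move=> mb mf; apply: measurable_fun_if => //.
apply: measurable_funS mf => //.
Qed.

Lemma measurable_setI_bool (b : T -> bool) : measurable_fun D b ->
  measurable (D `&` [set x | b x]).
Proof. by move=> mb; exact: mb. Qed.

End IntegralOfNonnegRealFunctions.

(** * Sums over dyadic levels *)

Section DyadicSum.
Context {R : realType}.
Variables (beta delta : R).
Hypotheses (beta0 : 0 < beta) (delta0 : 0 < delta).

Let lam k := delta * 2 ^+ k.

Let lam_gt0 k : 0 < lam k.
Proof. by rewrite mulr_gt0// exprn_gt0. Qed.

Let powR2_gt1 : 1 < 2 `^ beta :> R.
Proof. by have := gt0_ltr_powR beta0 _ _ (ltr1n R 2); rewrite !nnegrE powR1; apply. Qed.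

Let lamS k : lam k.+1 `^ beta = 2 `^ beta * lam k `^ beta.
Proof. by rewrite -powRM ?(ltW (lam_gt0 _))// /lam exprS mulrCA. Qed.

Let dyadic_sum n :
  (\sum_(k < n) lam k `^ beta) * (2 `^ beta - 1) <= lam n `^ beta.
Proof.
elim: n => [|n IH]; first by rewrite big_ord0 mul0r powR_ge0.
rewrite big_ord_recr/= mulrDl lamS.
have := powR_ge0 (lam n) beta; nra.
Qed.

(** A last level at or above [L] adds nothing. If the last level lies below [L], the full geometric
    sum is controlled by the next level, which is less than [2 * L]. *)
Lemma dyadic_truncated_sum (L : R) n : 0 <= L ->
  \sum_(k < n) (if L <= delta * 2 ^+ k then 0 else (delta * 2 ^+ k) `^ beta)
  <= 2 `^ beta / (2 `^ beta - 1) * L `^ beta.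
Proof.
move=> L0.
have c0 : 0 < 2 `^ beta - 1 by rewrite subr_gt0.
elim: n => [|n IH].
  by rewrite big_ord0 mulr_ge0 ?powR_ge0// divr_ge0 ?powR_ge0// ltW.
rewrite big_ord_recr/=; case: ifPn => [_|]; first by rewrite addr0.
rewrite -ltNge => Ln.
apply: (@le_trans _ _ (\sum_(k < n.+1) lam k `^ beta)).
  rewrite big_ord_recr/= lerD// ler_sum// => k _.
  by case: ifPn => // _; exact: powR_ge0.
rewrite mulrAC ler_pdivlMr//; apply: le_trans (dyadic_sum _) _.
rewrite lamS ler_wpM2l ?powR_ge0//.
by apply: ge0_ler_powR; rewrite ?nnegrE ?(ltW beta0)// ?(ltW (lam_gt0 n))// ltW.
Qed.

(** A discrete layer-cake formula: if [y] exceeds [delta], the term of the largest level below [y]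
    alone dominates y^p. Truncation at [lam n] keeps the sum finite. *)
Lemma dyadic_pointwise (p y : R) n : 0 < p -> 0 <= y ->
  (if y <= lam n then y `^ p else 0) <=
  delta `^ p + \sum_(k < n) (if lam k < y then lam k.+1 `^ p else 0).
Proof.
move=> p0 y0; elim: n => [|n IH].
  rewrite big_ord0 addr0; case: ifPn => [yl|_]; last exact: powR_ge0.
  apply: ge0_ler_powR; rewrite ?nnegrE ?(ltW p0)// ?(ltW delta0)//.
  by move: yl; rewrite /lam expr0 mulr1.
have S0 : 0 <= \sum_(k < n) (if lam k < y then lam k.+1 `^ p else 0).
  by apply: sumr_ge0 => k _; case: ifPn => // _; exact: powR_ge0.
rewrite big_ord_recr/=; have [yn|ny] := leP y (lam n).
  rewrite addr0; apply: le_trans IH; rewrite yn.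
  by case: ifPn => // _; exact: powR_ge0.
case: ifPn => [yn|_]; last by rewrite !addr_ge0// powR_ge0.
rewrite -[leLHS]add0r addrA lerD ?addr_ge0 ?powR_ge0//.
by apply: ge0_ler_powR; rewrite ?nnegrE ?(ltW p0)// (ltW (lam_gt0 _)).
Qed.

End DyadicSum.

(* Chemin-Xu: cut the transform at a frequency depending on the level. *)
Section WeightedEmbedding.
Context {R : realType} {d1 d2 : measure_display}.
Context {T1 : measurableType d1} {T2 : measurableType d2}.
Variables (mu : {measure set T1 -> \bar R}) (muh : {measure set T2 -> \bar R}).
Hypothesis mu1 : mu setT = 1%E.
Variables (S : set T2) (mS : measurable S).
Variables (f : T1 -> R) (y w : T2 -> R) (alpha s N B : R).
Hypotheses (mf : measurable_fun setT f) (f0 : forall x, 0 <= f x).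
Hypotheses (my : measurable_fun S y) (y0 : forall phi, 0 <= y phi).
Hypotheses (mw : measurable_fun S w) (w0 : forall phi, S phi -> 0 < w phi).
Hypotheses (s0 : 0 < s) (sa : s < alpha) (N0 : 0 < N) (B0 : 0 < B).
Hypothesis tail : forall (b : T2 -> bool) (l : R),
  measurable_fun S b -> 0 < l ->
  (\int[muh]_(phi in S) (if b phi then y phi else 0)%:E <= l%:E)%E ->
  (\int[mu]_x (if (8 * l < f x)%R then (4 * l) ^+ 2 else 0)%:E <=
   \int[muh]_(phi in S) (if b phi then 0 else y phi ^+ 2)%:E)%E.
Hypothesis IB : (\int[muh]_(phi in S) (w phi `^ (- alpha))%:E <= B%:E)%E.
Hypothesis IN : (\int[muh]_(phi in S) (w phi `^ s * y phi ^+ 2)%:E <= (N ^+ 2)%:E)%E.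

(** This [p] is the conjugate exponent p' of the theorem. *)
Let p := 2 * alpha / (alpha - s).
Let beta := 2 * s / (alpha - s).
(** At level lam the cut keeps the frequencies with [Lam phi <= lam]. The exponent makes Lam^beta a
    multiple of w^s, so that summing over levels restores the energy; the factor in front brings the
    integral of the low part down to lam / 8. *)
Let Lam phi := 8 * N * B `^ 2^-1 * w phi `^ ((alpha - s) / 2).

Let as0 : 0 < alpha - s. Proof. by rewrite subr_gt0. Qed.
Let beta0 : 0 < beta. Proof. by rewrite divr_gt0// mulr_gt0. Qed.
Let pE : p = beta + 2.
Proof. by rewrite /p /beta; field; rewrite gt_eqF. Qed.
Let p0 : 0 < p. Proof. by rewrite pE addr_gt0. Qed.

Let mpow (h : T2 -> R) r : measurable_fun S h -> measurable_fun S (fun phi => h phi `^ r).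
Proof.
move=> mh; exact: (@measurableT_comp _ _ _ _ _ _ (fun z : R => z `^ r)).
Qed.

Let mLam : measurable_fun S Lam.
Proof. by apply: measurable_funM => //; exact: mpow. Qed.

Let Lam0 phi : 0 <= Lam phi.
Proof. by rewrite !mulr_ge0 ?powR_ge0// ltW. Qed.

(** Cauchy-Schwarz in pointwise form: y <= k y^2 + 1 / (4 k) with k = lam w^s / (16 N^2). On the
    kept frequencies 1 / (4 k) is at most lam w^(- alpha) / (16 B), so that [IN] and [IB] contribute
    lam / 16 each. *)
Let low_pointwise lam phi : 0 < lam -> S phi -> Lam phi <= lam ->
  y phi <= lam / 16 / N ^+ 2 * (w phi `^ s * y phi ^+ 2) +
           lam / 16 / B * w phi `^ (- alpha).
Proof.
move=> lam0 Sphi Ll.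
have wp := w0 Sphi.
have L2 : 64 * N ^+ 2 * B * w phi `^ (alpha - s) <= lam ^+ 2.
  apply: (@le_trans _ _ (Lam phi ^+ 2)); last first.
    by rewrite ler_pXn2r ?nnegrE ?Lam0 ?(ltW lam0).
  have sqE x r : (x `^ r) ^+ 2 = x `^ (r * 2) :> R.
    by rewrite -powR_mulrn ?powR_ge0// -powRrM.
  rewrite /Lam !exprMn !sqE mulVf ?pnatr_eq0// (powRr1 (ltW B0)).
  by rewrite divfK ?pnatr_eq0//; lra.
set a := w phi `^ s; set c := w phi `^ (- alpha).
have a0 : 0 < a by exact: powR_gt0.
have c0 : 0 < c by exact: powR_gt0.
have wac : w phi `^ (alpha - s) * (a * c) = 1.
  rewrite -powRD ?(gt_eqF wp) ?implybT// -powRD ?(gt_eqF wp) ?implybT//.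
  by rewrite (_ : _ + _ = 0) ?powRr0//; ring.
have {}L2 : 64 * N ^+ 2 * B <= lam ^+ 2 * (a * c).
  have ac0 : 0 <= a * c by rewrite mulr_ge0// ltW.
  by have := ler_wpM2r ac0 L2; rewrite -(mulrA (64 * _ * _)) wac mulr1.
have : 4 * N ^+ 2 / lam / a <= lam / 16 / B * c.
  rewrite ler_pdivrMr// ler_pdivrMr//.
  have -> : lam / 16 / B * c * a * lam = lam ^+ 2 * (a * c) / (16 * B).
    by field; rewrite gt_eqF.
  rewrite ler_pdivlMr ?mulr_gt0//; lra.
apply: (le_trans _ \o lerD (lexx _)).
have -> : lam / 16 / N ^+ 2 * (a * y phi ^+ 2) + 4 * N ^+ 2 / lam / a =
    y phi + (lam / 16 / N ^+ 2 * a) * (y phi - 8 * N ^+ 2 / (lam * a)) ^+ 2.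
  by field; rewrite !gt_eqF.
by rewrite lerDl mulr_ge0 ?sqr_ge0// mulr_ge0 ?(ltW a0)// divr_ge0 ?sqr_ge0// divr_ge0// ltW.
Qed.

Let distribution_bound lam : 0 < lam ->
  (\int[mu]_x (if (lam < f x)%R then lam ^+ 2 / 4 else 0)%:E <=
   \int[muh]_(phi in S) (if (Lam phi <= lam)%R then 0 else y phi ^+ 2)%:E)%E.
Proof.
move=> lam0.
have mb : measurable_fun S (fun phi => Lam phi <= lam).
  exact: measurable_fun_ler.
have l0 : 0 < lam / 8 by rewrite divr_gt0.
have := tail mb l0.
have -> : 8 * (lam / 8) = lam by lra.
have -> : (4 * (lam / 8)) ^+ 2 = lam ^+ 2 / 4 by lra.
apply.
have mwy : measurable_fun S (fun phi => w phi `^ s * y phi ^+ 2).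
  by apply: measurable_funM; [exact: mpow|exact: measurable_funX].
have wy0 phi : S phi -> 0 <= w phi `^ s * y phi ^+ 2.
  by move=> _; rewrite mulr_ge0 ?powR_ge0 ?sqr_ge0.
have k1 : 0 <= lam / 16 / N ^+ 2 by rewrite !divr_ge0 ?sqr_ge0// ltW.
have k2 : 0 <= lam / 16 / B by rewrite !divr_ge0// ltW.
apply: (@le_trans _ _ (\int[muh]_(phi in S)
  (lam / 16 / N ^+ 2 * (w phi `^ s * y phi ^+ 2) +
   lam / 16 / B * w phi `^ (- alpha))%:E)%E).
  apply: le_integral_EFin => //.
  - exact: measurable_fun_guard.
  - by apply: measurable_funD; apply: measurable_funM => //; exact: mpow.
  - by move=> phi _; case: ifPn.
  - move=> phi Sphi; case: ifPn => [Ll|_]; first exact: low_pointwise.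
    by rewrite addr_ge0// mulr_ge0 ?powR_ge0// wy0.
rewrite integral_EFinD//.
- rewrite (integral_EFinZ muh mS k1)//.
  rewrite (integral_EFinZ muh mS k2)//; [|exact: mpow|by move=> *; exact: powR_ge0].
  rewrite (@le_trans _ _ ((lam / 16 / N ^+ 2)%:E * (N ^+ 2)%:E + (lam / 16 / B)%:E * B%:E)%E)//.
    by rewrite leeD// lee_wpmul2l.
  rewrite -!EFinM -EFinD lee_fin !divfK ?gt_eqF// ?exprn_gt0//; lra.
- exact: measurable_funM.
- by apply: measurable_funM => //; exact: mpow.
- by move=> phi Sphi; rewrite mulr_ge0// wy0.
- by move=> phi _; rewrite mulr_ge0// powR_ge0.
Qed.

(** Here 2 s / (alpha - s) is [beta], that is p' - 2. The factor 4 * 2^p' comes from passing between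
    consecutive levels, the quotient from the truncated geometric sum, and 8^beta from [Lam]. *)
Definition embedding_const (alpha s : R) : R :=
  4 * 2 `^ (2 * alpha / (alpha - s)) *
  (2 `^ (2 * s / (alpha - s)) / (2 `^ (2 * s / (alpha - s)) - 1)) *
  8 `^ (2 * s / (alpha - s)).

Let LamE phi : S phi -> Lam phi `^ beta =
  8 `^ beta * N `^ beta * B `^ (beta / 2) * w phi `^ s.
Proof.
move=> Sphi; rewrite /Lam powRM ?powR_ge0//; last first.
  by rewrite !mulr_ge0 ?powR_ge0// ltW.
rewrite powRM ?powR_ge0 ?mulr_ge0 ?(ltW N0)// powRM ?(ltW N0)// -!powRrM.
congr (_ * _ `^ _ * _ `^ _); first by rewrite mulrC.
by rewrite /beta; field; rewrite gt_eqF.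
Qed.

(** Each level is estimated by [distribution_bound]. After exchanging sum and integral, the levels
    below [Lam phi] add up to a multiple of (Lam phi)^beta, that is of w^s, and [IN] applies once
    for all of them. *)
Let truncated_bound (delta : R) n : 0 < delta ->
  (\int[mu]_x (if (f x <= delta * 2 ^+ n)%R then f x `^ p else 0)%:E <=
   (delta `^ p + embedding_const alpha s * (N `^ p * B `^ (beta / 2)))%:E)%E.
Proof.
move=> delta0; pose lam k := delta * 2 ^+ k.
have lam0 k : 0 < lam k by rewrite mulr_gt0// exprn_gt0.
(* As p = beta + 2, the p-th power of the next level is [c k] times the quantity lam_k^2 / 4 of
   [distribution_bound]. *)
pose c k := 4 * 2 `^ p * lam k `^ beta.
have c0 k : 0 <= c k by rewrite !mulr_ge0 ?powR_ge0.
have cE k : lam k.+1 `^ p = c k * (lam k ^+ 2 / 4).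
  rewrite /c /lam exprS mulrCA -/(lam k) powRM ?(ltW (lam0 k))//.
  rewrite [in lam k `^ p]pE powRD ?(gt_eqF (lam0 k)) ?implybT//.
  by rewrite powR_mulrn ?(ltW (lam0 k))//; lra.
pose g k x := c k * (if lam k < f x then lam k ^+ 2 / 4 else 0).
have mg0 k : measurable_fun setT (fun x => if lam k < f x then lam k ^+ 2 / 4 else 0).
  by apply: measurable_fun_guard => //; exact: measurable_fun_ltr.
have g00 k x : 0 <= (if lam k < f x then lam k ^+ 2 / 4 else 0).
  by case: ifPn => // _; rewrite divr_ge0// sqr_ge0.
have mg k : measurable_fun setT (g k) by exact: measurable_funM.
have g0 k x : 0 <= g k x by rewrite mulr_ge0.
pose h k phi := c k * (if Lam phi <= lam k then 0 else y phi ^+ 2).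
have mh0 k : measurable_fun S (fun phi => if Lam phi <= lam k then 0 else y phi ^+ 2).
  apply: measurable_fun_if => //; first exact: measurable_fun_ler.
  by apply: measurable_funS (measurable_funX 2 my).
have h00 k phi : 0 <= (if Lam phi <= lam k then 0 else y phi ^+ 2).
  by case: ifPn => // _; rewrite sqr_ge0.
have mh k : measurable_fun S (h k) by exact: measurable_funM.
have h0 k phi : 0 <= h k phi by rewrite mulr_ge0.
have msum : measurable_fun setT (fun x => \sum_(k < n) g k x).
  by apply: measurable_sum.
apply: (@le_trans _ _ (\int[mu]_x (delta `^ p + \sum_(k < n) g k x)%:E)%E).
  apply: le_integral_EFin => //.
  - apply: measurable_fun_guard => //; first exact: measurable_fun_ler.
    exact: (@measurableT_comp _ _ _ _ _ _ (fun z : R => z `^ p)).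
  - exact: measurable_funD.
  - by move=> x _; case: ifPn => // _; exact: powR_ge0.
  - move=> x _; have := @dyadic_pointwise R delta delta0 p (f x) n p0 (f0 x).
    move=> /le_trans; apply; rewrite lerD2l ler_sum// => k _.
    by rewrite /g -/(lam _) -/(lam _) cE; case: ifPn; rewrite ?mulr0.
rewrite integral_EFinD//; last 2 first.
- by move=> x _; exact: powR_ge0.
- by move=> x _; exact: sumr_ge0.
have -> : (\int[mu]_x (delta `^ p)%:E = (delta `^ p)%:E)%E.
  by have := integral_cst mu measurableT (delta `^ p)%:E; rewrite mu1 mule1.
rewrite EFinD leeD2l//.
apply: (@le_trans _ _ (\int[muh]_(phi in S) (\sum_(k < n) h k phi)%:E)%E).
  under eq_integral do rewrite -sumEFin.
  under [in leRHS]eq_integral do rewrite -sumEFin.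
  rewrite ge0_integral_sum//; [|by move=> k; exact/measurable_EFinP|by move=> k x _; rewrite lee_fin].
  rewrite ge0_integral_sum//; [|by move=> k; exact/measurable_EFinP|by move=> k x _; rewrite lee_fin].
  apply: lee_sum => k _.
  rewrite integral_EFinZ// integral_EFinZ//.
  by rewrite lee_wpmul2l ?lee_fin//; exact: distribution_bound.
pose K := 4 * 2 `^ p * (2 `^ beta / (2 `^ beta - 1)) * (8 `^ beta * N `^ beta * B `^ (beta / 2)).
have b1 : 1 < 2 `^ beta :> R.
  by have := gt0_ltr_powR beta0 _ _ (ltr1n R 2); rewrite !nnegrE powR1; apply.
have K0 : 0 <= K.
  by rewrite !mulr_ge0 ?powR_ge0// invr_ge0 subr_ge0 ltW.
apply: (@le_trans _ _ (\int[muh]_(phi in S) (K * (w phi `^ s * y phi ^+ 2))%:E)%E).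
  apply: le_integral_EFin => //.
  - exact: measurable_sum.
  - apply: measurable_funM => //.
    by apply: measurable_funM; [exact: mpow|exact: measurable_funX].
  - by move=> phi _; exact: sumr_ge0.
  - move=> phi Sphi.
    have -> : \sum_(k < n) h k phi = 4 * 2 `^ p * y phi ^+ 2 *
        \sum_(k < n) (if Lam phi <= lam k then 0 else lam k `^ beta).
      rewrite mulr_sumr; apply: eq_bigr => k _; rewrite /h /c.
      by case: ifPn => _; rewrite ?mulr0//; ring.
    have := @dyadic_truncated_sum R beta delta beta0 delta0 (Lam phi) n (Lam0 phi).
    rewrite LamE// => H.
    have k0 : 0 <= 4 * 2 `^ p * y phi ^+ 2 by rewrite !mulr_ge0 ?powR_ge0 ?sqr_ge0.
    by apply: le_trans (ler_wpM2l k0 H) _; rewrite le_eqVlt /K; apply/orP; left; apply/eqP; ring.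
rewrite integral_EFinZ//; last 2 first.
- by apply: measurable_funM; [exact: mpow|exact: measurable_funX].
- by move=> phi _; rewrite mulr_ge0 ?powR_ge0 ?sqr_ge0.
apply: (@le_trans _ _ (K%:E * (N ^+ 2)%:E)%E).
  by apply: lee_wpmul2l; rewrite ?lee_fin.
rewrite -EFinM lee_fin /K /embedding_const -/p -/beta.
rewrite [in N `^ p]pE powRD ?(gt_eqF N0) ?implybT// powR_mulrn ?(ltW N0)//.
by rewrite le_eqVlt; apply/orP; left; apply/eqP; ring.
Qed.

(** Monotone convergence removes the truncation, since every value of [f] lies below some level.
    [delta] stays free so that it can later be matched with the main term. *)
Lemma weighted_embedding (delta : R) : 0 < delta ->
  (\int[mu]_x (f x `^ (2 * alpha / (alpha - s)))%:E <=
   (delta `^ (2 * alpha / (alpha - s)) + embedding_const alpha s *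
      (N `^ (2 * alpha / (alpha - s)) * B `^ (s / (alpha - s))))%:E)%E.
Proof.
move=> delta0; rewrite -/p.
have -> : s / (alpha - s) = beta / 2 by rewrite /beta; field; rewrite gt_eqF.
pose g n x := (if f x <= delta * 2 ^+ n then f x `^ p else 0)%:E.
have mg n : measurable_fun setT (g n).
  apply/measurable_EFinP; apply: measurable_fun_guard => //.
    exact: measurable_fun_ler.
  exact: (@measurableT_comp _ _ _ _ _ _ (fun z : R => z `^ p)).
have g0 n x : setT x -> (0 <= g n x)%E.
  by rewrite lee_fin; case: ifPn => // _ _; exact: powR_ge0.
have ndg x : setT x -> {homo g^~ x : n m / (n <= m)%N >-> (n <= m)%E}.
  move=> _ n m nm; rewrite lee_fin; case: ifPn => [fn|_]; last first.
    by case: ifPn => // _; exact: powR_ge0.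
  by rewrite (le_trans fn)// ler_pM2l// ler_eXn2l// ltr1n.
have := cvg_monotone_convergence (mu := mu) measurableT mg g0 ndg.
have -> : (\int[mu]_x limn (g^~ x) = \int[mu]_x (f x `^ p)%:E)%E.
  apply: eq_integral => x _; apply/cvg_lim => //.
  apply: cvg_near_cst.
  have [m fm] : exists m, f x <= delta * 2 ^+ m.
    exists (Num.bound (f x / delta)).
    rewrite mulrC -ler_pdivrMr//.
    have := archi_boundP (divr_ge0 (f0 x) (ltW delta0)) => /ltW/le_trans; apply.
    by rewrite -natrX ler_nat ltnW// ltn_expl.
  by exists m => // n /= mn; rewrite /g (le_trans fm)// ler_pM2l// ler_eXn2l// ltr1n.
move=> cvg_g; rewrite -(cvg_lim _ cvg_g)//.
apply: lime_le; first by apply/cvg_ex; eexists; exact: cvg_g.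
by apply: nearW => n; exact: truncated_bound.
Qed.

Lemma embedding_const_gt0 : 0 < embedding_const alpha s.
Proof.
have b1 : 1 < 2 `^ beta :> R.
  by have := gt0_ltr_powR beta0 _ _ (ltr1n R 2); rewrite !nnegrE powR1; apply.
by rewrite /embedding_const !mulr_gt0 ?powR_gt0// invr_gt0 subr_gt0.
Qed.

(** With [delta := t] both terms of [weighted_embedding] equal t^p. The pointwise inequality f^q <=
    t^q + t^(q - p) f^p, used in place of Hölder's inequality, then yields t^q + 2 t^q, whence the
    3. *)
Lemma weighted_embedding_Lq (q : R) : 1 <= q <= 2 * alpha / (alpha - s) ->
  (\int[mu]_x (f x `^ q)%:E <=
   (3 * (embedding_const alpha s `^ (2 * alpha / (alpha - s))^-1 *
         (N * B `^ (s / (2 * alpha)))) `^ q)%:E)%E.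
Proof.
move=> /andP[q1 qp]; rewrite -/p; set t := _ * (N * _).
have a0 : 0 < alpha by apply: lt_trans sa.
have C0 := embedding_const_gt0.
have t0 : 0 < t by rewrite !mulr_gt0 ?powR_gt0.
have tp : t `^ p = embedding_const alpha s * (N `^ p * B `^ (s / (alpha - s))).
  rewrite /t powRM ?mulr_ge0 ?powR_ge0 ?(ltW N0)// powRM ?powR_ge0 ?(ltW N0)//.
  rewrite -!powRrM mulVf ?gt_eqF// powRr1 ?(ltW C0)//; congr (_ * (_ * _ `^ _)).
  by rewrite /p; field; rewrite !gt_eqF.
have := weighted_embedding t0; rewrite -/p -tp => Ip.
have mp (r : R) : measurable_fun setT (fun x => f x `^ r).
  exact: (@measurableT_comp _ _ _ _ _ _ (fun z : R => z `^ r)).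
apply: (@le_trans _ _ (\int[mu]_x (t `^ q + t `^ (q - p) * f x `^ p)%:E)%E).
  apply: le_integral_EFin => //.
  - by apply: measurable_funD => //; apply: measurable_funM.
  - by move=> x _; exact: powR_ge0.
  - move=> x _; have [fx|fx] := leP (f x) t.
      rewrite -[leLHS]addr0 lerD// ?mulr_ge0 ?powR_ge0//.
      apply: ge0_ler_powR; rewrite ?nnegrE ?f0 ?(ltW t0)//.
      exact: le_trans q1.
    have fx0 := lt_trans t0 fx.
    rewrite -[leLHS]add0r lerD ?powR_ge0//.
    have -> : f x `^ q = f x `^ (q - p) * f x `^ p.
      by rewrite -powRD ?subrK// (gt_eqF fx0) implybT.
    rewrite ler_wpM2r ?powR_ge0// -(opprB p q) !powRN lef_pV2 ?posrE ?powR_gt0//.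
    by apply: ge0_ler_powR; rewrite ?nnegrE ?subr_ge0 ?f0 ?(ltW t0)// ltW.
rewrite integral_EFinD//; last 3 first.
- exact: measurable_funM.
- by move=> x _; exact: powR_ge0.
- by move=> x _; rewrite mulr_ge0 ?powR_ge0.
rewrite (integral_EFinZ mu _ (powR_ge0 t (q - p)))//; last first.
  by move=> x _; exact: powR_ge0.
have -> : (\int[mu]_x (t `^ q)%:E = (t `^ q)%:E)%E.
  by have := integral_cst mu measurableT (t `^ q)%:E; rewrite mu1 mule1.
apply: (@le_trans _ _ ((t `^ q)%:E + (t `^ (q - p))%:E * (t `^ p + t `^ p)%:E)%E).
  by rewrite leeD2l// lee_wpmul2l// lee_fin powR_ge0.
rewrite -EFinM -EFinD lee_fin mulrDr.
have -> : t `^ (q - p) * t `^ p = t `^ q.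
  by rewrite -powRD ?subrK// (gt_eqF t0) implybT.
lra.
Qed.

End WeightedEmbedding.

(** * Limits along an ultrafilter *)

Section UltrafilterLimits.
Context {R : realType} (U : set_system nat) {UU : UltraFilter U}.

(** Compactness gives a cluster point of the image filter. If the indices within [eps] of it were
    not [U]-large, those farther away would be, which a cluster point forbids. *)
Lemma ultra_bounded_cvg (c : nat -> R) (M : R) : (forall n, `|c n| <= M) ->
  exists l, forall eps : R, 0 < eps -> U [set n | `|c n - l| <= eps].
Proof.
move=> cM; have := @segment_compact R (- M) M.
move=> /(_ (c @ U) (fmap_proper_filter _ _))[|l [_ lcl]].
  apply: (@filterE _ U _ (c @^-1` `[- M, M])) => n.
  by rewrite /= in_itv/= -ler_norml.
exists l => eps eps0.
have [//|UC] := in_ultra_setVsetC [set n | `|c n - l| <= eps] UU.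
have UC' : U (c @^-1` [set z | eps < `|z - l|]).
  by apply: (filterS _ UC) => n nc; rewrite /= ltNge; apply/negP.
have [z [/= z1 z2]] := lcl [set z | eps < `|z - l|] _ UC' (nbhsx_ballx l eps eps0).
by move: z2; rewrite /ball/= distrC ltNge (ltW z1).
Qed.

(** [U] refines the filter at infinity, so a [U]-large set has elements beyond any index; properties
    that hold along [U] are thus realised one after the other by an ordinary subsequence. *)
Lemma strict_extraction (P : nat -> nat -> Prop) : \oo `<=` U ->
  (forall k, U [set n | P k n]) ->
  exists sigma : nat -> nat,
    (forall n, (sigma n < sigma n.+1)%N) /\ forall k, P k (sigma k).
Proof.
move=> ooU UP.
have H (km : nat * nat) : exists n, (km.2 < n)%N /\ P km.1 n.
  have : U ([set n | (km.2 < n)%N] `&` [set n | P km.1 n]).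
    by apply: filterI => //; apply: ooU; exists km.2.+1.
  by move=> /filter_ex[n []]; exists n.
have [pick pickP] := choice H.
pose sigma := fix sg k := if k is k'.+1 then pick (k, sg k') else pick (0, 0)%N.
exists sigma; split=> [n|[|k]]; first exact: (pickP (n.+1, sigma n)).1.
- exact: (pickP (0, 0)%N).2.
- exact: (pickP (k.+1, sigma k)).2.
Qed.

End UltrafilterLimits.

(** * Measurable functions on an atom *)

Section AtomicMeasure.
Context {R : realType} d {T : measurableType d} (nu : {measure set T -> \bar R}).

(** The constant is the supremum of the r for which f < r only on a null subset of [X]; for every
    larger r the atom property gives f < r almost everywhere. *)
Lemma atom_ae_cst (X : set T) (f : T -> R) : measurable X -> nu X != 0%E ->
  (forall Y, measurable Y -> Y `<=` X -> nu Y = 0%E \/ nu (X `\` Y) = 0%E) ->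
  measurable_fun X f ->
  exists c, {ae nu, forall x, X x -> f x = c}.
Proof.
move=> mX X0 atom mf.
have mlt r : measurable (X `&` [set x | f x < r]).
  by apply: (@measurable_setI_bool _ _ X mX (fun x => f x < r)); apply: measurable_fun_ltr.
have mge r : measurable (X `&` [set x | r <= f x]).
  by apply: (@measurable_setI_bool _ _ X mX (fun x => r <= f x)); apply: measurable_fun_ler.
have ge_lt r : X `\` (X `&` [set x | f x < r]) = X `&` [set x | r <= f x].
  apply/seteqP; split=> x /=.
    by move=> [Xx h]; split => //; rewrite leNgt; apply/negP => ?; apply: h.
  by move=> [Xx rf]; split=> // -[_]; rewrite ltNge rf.
have null_ae r : nu (X `&` [set x | f x < r]) = 0%E -> {ae nu, forall x, X x -> r <= f x}.
  move=> h; exists (X `&` [set x | f x < r]); split=> // x /= /not_implyP[Xx].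
  by move=> /negP; rewrite -ltNge.
have nnull_ae r : nu (X `&` [set x | f x < r]) <> 0%E -> {ae nu, forall x, X x -> f x < r}.
  move=> h; have [//|] := atom _ (mlt r) (@subIsetl _ _ _); rewrite ge_lt => {}h.
  exists (X `&` [set x | r <= f x]); split=> // x /= /not_implyP[Xx].
  by move=> /negP; rewrite -leNgt.
have Xnull : {ae nu, forall x, ~ X x} -> False.
  move=> [N [mN N0 XN]]; move/eqP: X0; apply.
  apply: (subset_measure0 mX mN _ N0).
  by move=> x Xx; apply: XN => /(_ Xx).
pose A := [set r | nu (X `&` [set x | f x < r]) = 0%E].
have Adown r r' : r' <= r -> A r -> A r'.
  move=> rr' Ar; apply: (subset_measure0 (mlt r') (mlt r) _ Ar).
  by move=> x [Xx fx]; split=> //; exact: lt_le_trans fx rr'.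
(* If no r qualified, f would lie below every - n almost everywhere on [X], and [X] would be null.
   The upper bound is symmetric. *)
have [r1 Ar1] : exists r, A r.
  apply: contrapT => /forallNP nA; apply: Xnull.
  have : {ae nu, forall x, forall n : nat, X x -> f x < - n%:R}.
    by apply: ae_foralln => n; apply: nnull_ae; exact: nA.
  apply: filterS => x h Xx.
  have := h (Num.bound `|f x|) Xx; apply/negP; rewrite -leNgt lerNl.
  apply: le_trans (ltW (archi_boundP (normr_ge0 (f x)))).
  by rewrite -normrN ler_norm.
have [r2 Ar2] : exists r, ~ A r.
  apply: contrapT => /forallNP nA; apply: Xnull.
  have : {ae nu, forall x, forall n : nat, X x -> n%:R <= f x}.
    by apply: ae_foralln => n; apply: null_ae; apply: contrapT; exact: nA.
  apply: filterS => x h Xx.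
  have := h (Num.bound `|f x|) Xx; apply/negP; rewrite -ltNge.
  by apply: le_lt_trans (archi_boundP (normr_ge0 (f x))); exact: ler_norm.
have supA : has_sup A.
  split; first by exists r1.
  exists r2 => r Ar; rewrite leNgt; apply/negP => /ltW r2r.
  by apply: Ar2; exact: Adown Ar.
exists (sup A).
have lo : {ae nu, forall x, forall n : nat, X x -> sup A - n.+1%:R^-1 <= f x}.
  apply: ae_foralln => n; apply: null_ae.
  have n0 : 0 < n.+1%:R^-1 :> R by rewrite invr_gt0.
  have [r Ar /ltW rs] := sup_adherent n0 supA.
  exact: Adown Ar.
have hi : {ae nu, forall x, forall n : nat, X x -> f x < sup A + n.+1%:R^-1}.
  apply: ae_foralln => n; apply: nnull_ae => /(ub_le_sup supA.2).
  by apply/negP; rewrite -ltNge ltrDl invr_gt0.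
move: lo hi; apply: filterS2 => x lo hi Xx.
apply/eqP; rewrite eq_le; apply/andP; split; apply/ler_addgt0Pr => e e0.
  have [n ne] : exists n : nat, n.+1%:R^-1 < e.
    exists (Num.bound e^-1); rewrite -[ltRHS]invrK ltf_pV2 ?posrE ?invr_gt0//.
    by apply: lt_trans (archi_boundP _) _; rewrite ?invr_ge0 ?(ltW e0)// ltr_nat.
  by apply: le_trans (ltW (hi n Xx)) _; rewrite lerD2l ltW.
have [n ne] : exists n : nat, n.+1%:R^-1 < e.
  exists (Num.bound e^-1); rewrite -[ltRHS]invrK ltf_pV2 ?posrE ?invr_gt0//.
  by apply: lt_trans (archi_boundP _) _; rewrite ?invr_ge0 ?(ltW e0)// ltr_nat.
by have := lo n Xx; rewrite lerBlDr => /le_trans; apply; rewrite lerD2l ltW.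
Qed.

End AtomicMeasure.

(* Sets of finite measure split into finitely many atoms. *)
Section GapMeasure.
Context {R : realType} d {T : measurableType d} (nu : {measure set T -> \bar R}).
Variables (S : set T) (kappa : R).
Hypotheses (mS : measurable S) (kappa0 : 0 < kappa).
Hypothesis gap : forall E, measurable E -> E `<=` S -> (nu E < +oo)%E ->
  nu E = 0%E \/ (kappa%:E <= nu E)%E.
Context (U : set_system nat) {UU : UltraFilter U}.

(** Induction on the measure in units of [kappa]: a set that is not an atom splits into two parts of
    measure at least [kappa], so both parts fall under the induction hypothesis. On an atom [h n] is
    almost everywhere a constant, bounded in n by the L^2 bound. All limits run along the same [U],
    so the parts are glued without passing to subsequences. *)
Lemma gap_ultra_limit (h : nat -> T -> R) (M : R) (E : set T) :
  (forall n, measurable_fun S (h n)) ->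
  (forall n, (\int[nu]_(x in S) (h n x ^+ 2)%:E <= M%:E)%E) ->
  measurable E -> E `<=` S -> (nu E < +oo)%E ->
  exists L : T -> R, forall eps : R, 0 < eps ->
    U [set n | {ae nu, forall x, E x -> `|h n x - L x| <= eps}].
Proof.
move=> mh hM.
suff rec k : forall E, measurable E -> E `<=` S -> (nu E < (k%:R * kappa)%:E)%E ->
  exists L : T -> R, forall eps : R, 0 < eps ->
    U [set n | {ae nu, forall x, E x -> `|h n x - L x| <= eps}].
  move=> mE ES Efin; have Ef : nu E \is a fin_num by rewrite ge0_fin_numE.
  apply: (rec (Num.bound (fine (nu E) / kappa))) => //.
  rewrite -[ltLHS]fineK// lte_fin -ltr_pdivrMr// archi_boundP//.
  by rewrite divr_ge0 ?fine_ge0// ltW.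
elim: k => [|k IH] {}E mE ES Ek.
  by move: Ek; rewrite mul0r ltNge measure_ge0.
have Efin : (nu E < +oo)%E by apply: lt_trans Ek _; rewrite ltry.
have [E0|kE] := gap mE ES Efin.
  exists (fun=> 0) => eps eps0; apply: filterE => n /=.
  by exists E; split=> // x /= /not_implyP[].
have E0 : nu E != 0%E by rewrite gt_eqF// (lt_le_trans _ kE)// lte_fin.
have [atom|] := pselect (forall Y, measurable Y -> Y `<=` E ->
    nu Y = 0%E \/ nu (E `\` Y) = 0%E).
  have mhE n : measurable_fun E (h n) by apply: measurable_funS (mh n).
  have /choice[c hc] n : exists c, {ae nu, forall x, E x -> h n x = c}.
    exact: atom_ae_cst.
  have cb n : `|c n| <= M / kappa + 1.
    have c2 : c n ^+ 2 * kappa <= M.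
      rewrite -lee_fin; apply: le_trans (hM n).
      apply: (@le_trans _ _ (\int[nu]_(x in E) (c n ^+ 2)%:E)%E).
        rewrite integral_cst// EFinM lee_wpmul2l// lee_fin sqr_ge0//.
      apply: (@le_trans _ _ (\int[nu]_(x in E) (h n x ^+ 2)%:E)%E).
        apply: ae_le_integral_EFin => //.
        - exact: measurable_funX.
        - by move=> x _; exact: sqr_ge0.
        - by move=> x _; exact: sqr_ge0.
        - by apply: filterS (hc n) => x + Ex => ->.
      apply: ge0_subset_integral => //.
      - by apply/measurable_EFinP; exact: measurable_funX.
      - by move=> x _; rewrite lee_fin sqr_ge0.
    have {}c2 : `|c n| ^+ 2 <= M / kappa.
      by rewrite real_normK ?num_real// ler_pdivlMr.
    have := normr_ge0 (c n); have := sqr_ge0 (`|c n| - 1); nra.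
  have [l lP] := ultra_bounded_cvg cb.
  exists (fun=> l) => eps eps0; apply: filterS (lP eps eps0) => n /= cl.
  by apply: filterS (hc n) => x + Ex => ->.
move=> /existsNP[Y /not_implyP[mY /not_implyP[YE /not_orP[Y0 Y1]]]].
have mEY : measurable (E `\` Y) by exact: measurableD.
have EYE : E `\` Y `<=` E by exact: subDsetl.
have nuE : nu E = (nu Y + nu (E `\` Y))%E.
  rewrite -measureU//; first by rewrite setDUK.
  by rewrite setDIK.
have Yfin : (nu Y < +oo)%E by apply: le_lt_trans Efin; apply: le_measure; rewrite ?inE.
have EYfin : (nu (E `\` Y) < +oo)%E.
  by apply: le_lt_trans Efin; apply: le_measure; rewrite ?inE.
have [//|kY] := gap mY (subset_trans YE ES) Yfin.
have [//|kEY] := gap mEY (subset_trans EYE ES) EYfin.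
have Yf : nu Y \is a fin_num by rewrite ge0_fin_numE.
have EYf : nu (E `\` Y) \is a fin_num by rewrite ge0_fin_numE.
have [Yk EYk] : (nu Y < (k%:R * kappa)%:E)%E /\ (nu (E `\` Y) < (k%:R * kappa)%:E)%E.
  move: Ek kY kEY; rewrite nuE -(fineK Yf) -(fineK EYf) -EFinD !lte_fin !lee_fin.
  by rewrite -natr1 mulrDl mul1r => *; split; lra.
have [L1 L1P] := IH Y mY (subset_trans YE ES) Yk.
have [L2 L2P] := IH _ mEY (subset_trans EYE ES) EYk.
exists (fun x => if x \in Y then L1 x else L2 x) => eps eps0.
apply: filterS2 (L1P _ eps0) (L2P _ eps0) => n /=.
apply: filterS2 => x h1 h2 Ex; case: ifPn => [|xY].
  by rewrite inE => /h1.
by apply: h2; split=> //; move: xY; rewrite notin_setE.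
Qed.

(** Diagonal extraction: index k asks for an error at most 1 / (k + 1) on all levels j <= k. The 2
    in the conclusion adds real and imaginary parts. *)
Lemma gap_subsequence (w : T -> R) (H : nat -> T -> R[i]) (M : R) :
  \oo `<=` U -> measurable_fun S w ->
  (forall j : nat, (nu (S `&` [set x | (w x <= j%:R)%R]) < +oo)%E) ->
  (forall n, measurable_fun S (fun x => complex.Re (H n x))) ->
  (forall n, measurable_fun S (fun x => complex.Im (H n x))) ->
  (forall n, (\int[nu]_(x in S) (cabs (H n x) ^+ 2)%:E <= M%:E)%E) ->
  exists (sigma : nat -> nat) (h : T -> R[i]),
    [/\ forall n, (sigma n < sigma n.+1)%N,
        measurable_fun S (fun x => complex.Re (h x)),
        measurable_fun S (fun x => complex.Im (h x)) &
        forall j k : nat, (j <= k)%N -> {ae nu, forall x, S x -> w x <= j%:R ->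
          cabs (H (sigma k) x - h x) <= 2 / k.+1%:R}].
Proof.
move=> ooU mw Efin mr mi HM.
pose E (j : nat) := S `&` [set x | w x <= j%:R].
have mE j : measurable (E j).
  apply: (@measurable_setI_bool _ _ S mS (fun x => w x <= j%:R)).
  exact: measurable_fun_ler.
have mH n := measurable_cabs (mr n) (mi n).
have part (c : R[i] -> R) : (forall z, `|c z| <= cabs z) ->
    (forall n, measurable_fun S (fun x => c (H n x))) ->
    forall j, exists L : T -> R, forall eps : R, 0 < eps ->
      U [set n | {ae nu, forall x, E j x -> `|c (H n x) - L x| <= eps}].
  move=> cle mc j; apply: (gap_ultra_limit (M := M)) => //.
  - move=> n; apply: le_trans (HM n); apply: le_integral_EFin => //.
    + exact: measurable_funX.
    + exact: measurable_funX.
    + by move=> x _; exact: sqr_ge0.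
    + move=> x _; rewrite -[leLHS]real_normK ?num_real//.
      by rewrite ler_pXn2r ?nnegrE ?cabs_ge0.
  - by move=> x [].
  - exact: Efin.
have /choice[Lr LrP] := part _ normRe_le_cabs mr.
have /choice[Li LiP] := part _ normIm_le_cabs mi.
pose P (k n : nat) := forall j, (j < k.+1)%N -> {ae nu, forall x, E j x ->
  `|complex.Re (H n x) - Lr j x| <= k.+1%:R^-1 /\
  `|complex.Im (H n x) - Li j x| <= k.+1%:R^-1}.
have UP k : U [set n | P k n].
  have k0 : 0 < k.+1%:R^-1 :> R by rewrite invr_gt0.
  suff aux m : U [set n | forall j, (j < m)%N -> {ae nu, forall x, E j x ->
      `|complex.Re (H n x) - Lr j x| <= k.+1%:R^-1 /\
      `|complex.Im (H n x) - Li j x| <= k.+1%:R^-1}] by exact: aux.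
  elim: m => [|m IH]; first by apply: filterE.
  have FU : Filter U by typeclasses eauto.
  have Hri := @filterI _ U FU _ _ (LrP m _ k0) (LiP m _ k0).
  apply: (@filterS _ U FU _ _ _ (@filterI _ U FU _ _ IH Hri)) => n [IHn [Hr Hi]] j.
  rewrite ltnS leq_eqVlt => /predU1P[->|]; last exact: IHn.
  by apply: filterS2 Hr Hi => x hr hi Ex; split; [exact: hr|exact: hi].
have [sigma [sigma_incr sigmaP]] := strict_extraction ooU UP.
have : {ae nu, forall x, forall k j, (j < k.+1)%N -> E j x ->
    `|complex.Re (H (sigma k) x) - Lr j x| <= k.+1%:R^-1 /\
    `|complex.Im (H (sigma k) x) - Li j x| <= k.+1%:R^-1}.
  apply: ae_foralln => k; apply: ae_foralln => j.
  have [jk|jk] := boolP (j < k.+1)%N; last by apply: aeW => x /=.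
  by apply: filterS (sigmaP k j jk) => x hx _.
move=> [Z [mZ Z0 ZP]].
have good x : ~ Z x -> forall k j, (j < k.+1)%N -> E j x ->
    `|complex.Re (H (sigma k) x) - Lr j x| <= k.+1%:R^-1 /\
    `|complex.Im (H (sigma k) x) - Li j x| <= k.+1%:R^-1.
  by move=> nZ; apply: contrapT => /ZP.
have inv_cvg0 (u : nat -> R) (l : R) (j : nat) :
    (forall k, (j < k.+1)%N -> `|u k - l| <= k.+1%:R^-1) -> u @ \oo --> l.
  move=> ul; apply/cvgrPdist_le => e e0.
  have := @cvg_harmonic R => /cvgrPdist_le/(_ e e0)[m _ mP].
  exists (maxn m j) => // k /=; rewrite geq_max => /andP[mk jk].
  rewrite distrC; apply: le_trans (ul k _) _; first by rewrite ltnS.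
  by have := mP k mk; rewrite sub0r normrN ger0_norm ?harmonic_ge0.
have Eex x : S x -> exists j, E j x.
  move=> Sx; exists (Num.bound `|w x|); split=> //=.
  by apply: le_trans (ler_norm _) (ltW (archi_boundP _)).
(* The limits from [gap_ultra_limit] are not known to be measurable. Functions set to 0 on the
   exceptional null set [Z] converge at every point of [S], which makes the limit [h] measurable. *)
pose g c k x := (\1_(~` Z) x : R) * c (H (sigma k) x).
have mg (c : R[i] -> R) : (forall n, measurable_fun S (fun x => c (H n x))) ->
    forall k, measurable_fun S (g c k).
  by move=> mc k; apply: measurable_funM => //; apply: measurable_indic; exact: measurableC.
have gZ c x k : Z x -> g c k x = 0.
  by move=> Zx; rewrite /g indicE memNset ?mul0r//= => /(_ Zx).
have gnZ c x k : ~ Z x -> g c k x = c (H (sigma k) x).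
  by move=> nZ; rewrite /g indicE mem_set ?mul1r.
pose h x : R[i] := Complex (limn (fun k => g (@complex.Re R) k x)) (limn (fun k => g (@complex.Im R) k x)).
have gcvg x j : ~ Z x -> E j x ->
    (fun k => g (@complex.Re R) k x) @ \oo --> Lr j x /\
    (fun k => g (@complex.Im R) k x) @ \oo --> Li j x.
  move=> nZ Ej; split; apply: (inv_cvg0 _ _ j) => k jk; rewrite gnZ//.
  - exact: (good x nZ k j jk Ej).1.
  - exact: (good x nZ k j jk Ej).2.
have gcvgS (x : T) : S x ->
    (fun k => g (@complex.Re R) k x) @ \oo --> complex.Re (h x) /\
    (fun k => g (@complex.Im R) k x) @ \oo --> complex.Im (h x).
  move=> Sx; have [Zx|nZ] := pselect (Z x).
    have gE c : (fun k => g c k x) = cst 0 by apply/funext => k; exact: gZ.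
    by rewrite /h /= !gE lim_cst//; split; exact: cvg_cst.
  have [j Ej] := Eex x Sx; have [c1 c2] := gcvg x j nZ Ej.
  by rewrite /h/= (cvg_lim _ c1)// (cvg_lim _ c2).
exists sigma, h; split => //.
- by apply: (measurable_fun_cvg (mg _ mr)) => x Sx; exact: (gcvgS x Sx).1.
- by apply: (measurable_fun_cvg (mg _ mi)) => x Sx; exact: (gcvgS x Sx).2.
move=> j k jk; exists Z; split=> // x /= /not_implyP[Sx /not_implyP[wx hx]].
apply: contrapT => nZ; apply: hx.
have Ej : E j x by [].
have [c1 c2] := gcvg x j nZ Ej.
have jk1 : (j < k.+1)%N by rewrite ltnS.
have [g1 g2] := good x nZ k j jk1 Ej.
apply: le_trans (cabs_le_normReIm _) _.
have subE (z z' : R[i]) : complex.Re (z - z') = complex.Re z - complex.Re z' /\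
  complex.Im (z - z') = complex.Im z - complex.Im z' by case: z; case: z'.
rewrite (subE _ _).1 (subE _ _).2 /h/= (cvg_lim _ c1)// (cvg_lim _ c2)//.
by apply: le_trans (lerD g1 g2) _; rewrite -mulr2n -[leRHS]mulrC mulr_natr.
Qed.

End GapMeasure.

(** * Square-integrable functions and the Plancherel isometry *)

Lemma in_L2P (R : realType) d (T : measurableType d)
    (mu : {measure set T -> \bar R}) (D : set T) (f : T -> R[i]) :
  in_Lp mu D 2 f <->
  [/\ measurable_fun D (fun x => complex.Re (f x)),
      measurable_fun D (fun x => complex.Im (f x)) &
      (\int[mu]_(x in D) ((cabs (f x)) ^+ 2)%:E < +oo)%E].
Proof.
rewrite /in_Lp.
have -> : (\int[mu]_(x in D) ((cabs (f x)) `^ 2)%:E =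
           \int[mu]_(x in D) ((cabs (f x)) ^+ 2)%:E)%E.
  by apply: eq_integral => x _; rewrite powR_mulrn// cabs_ge0.
by [].
Qed.

(* [F] is an abstract Plancherel transform; [V] is the class of invariant
   functions, closed under pointwise operations. *)
Section PlancherelSetting.
Context {R : realType} {d1 d2 : measure_display}.
Context {T1 : measurableType d1} {T2 : measurableType d2}.
Variables (mu : {measure set T1 -> \bar R}) (muh : {measure set T2 -> \bar R}).
Variables (S : set T2) (V : (T1 -> R[i]) -> Prop).
Variable F : (T1 -> R[i]) -> T2 -> R[i].
Hypothesis mS : measurable S.
Hypothesis mu1 : mu setT = 1%E.
Hypothesis V_comp : forall (t : R[i] -> R[i]) f, V f -> V (fun x => t (f x)).
Hypothesis V_lin : forall (a : R[i]) f g, V f -> V g -> V (fun x => a * f x + g x).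
Hypothesis F_bound : forall f, V f ->
  in_Lp mu setT 1 f -> in_Lp mu setT 2 f ->
  {ae muh, forall phi, S phi ->
    ((cabs (F f phi))%:E <= 4%:E * \int[mu]_x (cabs (f x))%:E)%E}.
Hypothesis F_isom : forall f, V f -> in_Lp mu setT 2 f ->
  in_Lp muh S 2 (F f) /\ Lp_norm muh S 2 (F f) = Lp_norm mu setT 2 f.
Hypothesis F_lin : forall (a : R[i]) f g, V f -> V g ->
  in_Lp mu setT 2 f -> in_Lp mu setT 2 g ->
  {ae muh, forall phi, S phi ->
     F (fun x => a * f x + g x) phi = a * F f phi + F g phi}.
Hypothesis F_surj : forall h, in_Lp muh S 2 h ->
  exists f, [/\ V f, in_Lp mu setT 2 f &
                {ae muh, forall phi, S phi -> F f phi = h phi}].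

Let W f := V f /\ in_Lp mu setT 2 f.

Lemma plancherel_measurable f : W f ->
  measurable_fun S (fun phi => complex.Re (F f phi)) /\
  measurable_fun S (fun phi => complex.Im (F f phi)).
Proof. by move=> [Vf f2]; have [[]] := F_isom Vf f2. Qed.

Lemma plancherel_measurable_cabs f : W f ->
  measurable_fun S (fun phi => cabs (F f phi)).
Proof. by move=> /plancherel_measurable[? ?]; exact: measurable_cabs. Qed.

Lemma plancherel_sqr f : W f ->
  (\int[muh]_(phi in S) (cabs (F f phi) ^+ 2)%:E =
   \int[mu]_x (cabs (f x) ^+ 2)%:E)%E.
Proof.
move=> [Vf f2]; have [Ff2 nF] := F_isom Vf f2.
move: Ff2 f2 => /in_L2P[_ _ iF] /in_L2P[_ _ If].
have F0 : (0 <= \int[muh]_(phi in S) (cabs (F f phi) ^+ 2)%:E)%E.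
  by apply: integral_ge0 => x _; rewrite lee_fin sqr_ge0.
have f0 : (0 <= \int[mu]_x (cabs (f x) ^+ 2)%:E)%E.
  by apply: integral_ge0 => x _; rewrite lee_fin sqr_ge0.
(* [Lp_norm] passes through [fine]; both integrals are finite, so the equality of norms lifts to the
   extended integrals. *)
rewrite -(@fineK _ (\int[muh]_(_ in _) _)%E) ?ge0_fin_numE//.
rewrite -(@fineK _ (\int[mu]_(_ in _) _)%E) ?ge0_fin_numE//; congr (_%:E).
move: nF; rewrite /Lp_norm /Rintegral.
under eq_integral do rewrite powR_mulrn ?cabs_ge0//.
under [in RHS]eq_integral do rewrite powR_mulrn ?cabs_ge0//.
by apply: powR_injective => //; rewrite nnegrE fine_ge0.
Qed.

Lemma plancherel_lin a f g : W f -> W g -> W (fun x => a * f x + g x).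
Proof.
move=> [Vf /in_L2P[fr fi If]] [Vg /in_L2P[gr gi Ig]]; split; first exact: V_lin.
apply/in_L2P.
have mr : measurable_fun setT (fun x => complex.Re (a * f x + g x)).
  under eq_fun do rewrite complexReD complexReM.
  by apply: measurable_funD => //; apply: measurable_funB; apply: measurable_funM.
have mi : measurable_fun setT (fun x => complex.Im (a * f x + g x)).
  under eq_fun do rewrite complexImD complexImM.
  by apply: measurable_funD => //; apply: measurable_funD; apply: measurable_funM.
split => //.
have mf := measurable_cabs fr fi.
have mg := measurable_cabs gr gi.
apply: (@le_lt_trans _ _ (\int[mu]_x ((2 * cabs a ^+ 2) * cabs (f x) ^+ 2
    + 2 * cabs (g x) ^+ 2)%:E)%E).
  apply: le_integral_EFin => //.
  - by apply: measurable_funX; exact: measurable_cabs.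
  - apply: measurable_funD; apply: measurable_funM => //;
      exact: measurable_funX.
  - by move=> x _; exact: sqr_ge0.
  - move=> x _; have := cabsD (a * f x) (g x); rewrite cabsM.
    have := cabs_ge0 (a * f x + g x).
    have := cabs_ge0 (a * f x); rewrite cabsM.
    have := cabs_ge0 (g x).
    set u := cabs (a * f x + g x); set b := cabs a; set c := cabs (f x).
    set e := cabs (g x) => e0 bc0 u0 ue.
    apply: (@le_trans _ _ ((b * c + e) ^+ 2)).
      by rewrite ler_pXn2r// nnegrE addr_ge0.
    have := sqr_ge0 (b * c - e); nra.
have k0 : 0 <= 2 * cabs a ^+ 2 by rewrite mulr_ge0// sqr_ge0.
have mf2 : measurable_fun setT (fun x => cabs (f x) ^+ 2) by exact: measurable_funX.
have mg2 : measurable_fun setT (fun x => cabs (g x) ^+ 2) by exact: measurable_funX.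
rewrite integral_EFinD//.
- rewrite (integral_EFinZ mu _ k0)// => [|x _]; last exact: sqr_ge0.
  rewrite (integral_EFinZ mu _ (k := 2))// => [|x _]; last exact: sqr_ge0.
  by apply: lte_add_pinfty; apply: lte_mul_pinfty => //; rewrite lee_fin.
- exact: measurable_funM.
- exact: measurable_funM.
- by move=> x _; rewrite mulr_ge0// sqr_ge0.
- by move=> x _; rewrite mulr_ge0// sqr_ge0.
Qed.

Let integral_cst_prob (k : R) : (\int[mu]_x k%:E = k%:E)%E.
Proof. by have := integral_cst mu measurableT k%:E; rewrite mu1 mule1. Qed.

Let phase (c : R) (z : R[i]) : R[i] :=
  if c < cabs z then z * ((cabs z)^-1)%:C%C else 0.

Let cabs_phase (c : R) z : 0 <= c -> cabs (phase c z) = if c < cabs z then 1 else 0.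
Proof.
move=> c0; rewrite /phase; case: ifPn => [cz|_]; last exact: cabs0.
have z0 := le_lt_trans c0 cz.
by rewrite cabsM cabs_real ?invr_ge0 ?cabs_ge0// divff// gt_eqF.
Qed.

(** [phase c z] is a nonnegative multiple of [z], so the cross term is exact; this plays the part of
    an inner product. The factor 1 matches the shape of [F_lin]. *)
Let cabs_phaseD (c : R) z : 0 <= c -> cabs (1 * phase c z + z) ^+ 2 =
  cabs z ^+ 2 + cabs (phase c z) ^+ 2 + 2 * (if c < cabs z then cabs z else 0).
Proof.
move=> c0; rewrite cabs_phase// /phase mul1r; case: ifPn => [cz|_]; last first.
  by rewrite add0r; ring.
have z0 := le_lt_trans c0 cz.
have -> : z * ((cabs z)^-1)%:C%C + z = z * ((cabs z)^-1 + 1)%:C%C.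
  by rewrite rmorphD/= rmorph1 mulrDr mulr1.
rewrite cabsM cabs_real ?addr_ge0 ?invr_ge0 ?cabs_ge0// mulrDr divff ?gt_eqF//.
ring.
Qed.

Let phase_in_Lp (c : R) f : 0 <= c -> W f ->
  [/\ V (fun x => phase c (f x)), in_Lp mu setT 1 (fun x => phase c (f x)) &
      in_Lp mu setT 2 (fun x => phase c (f x))].
Proof.
move=> c0 [Vf [mr mi _]].
have mf := measurable_cabs mr mi.
have mb : measurable_fun setT (fun x => c < cabs (f x)).
  by apply: measurable_fun_ltr.
have mV : measurable_fun setT (fun x => if c < cabs (f x) then (cabs (f x))^-1 else 0).
  apply: measurable_fun_guard => //.
  under eq_fun do rewrite -powR_inv1 ?cabs_ge0//.
  by apply: (measurableT_comp (f := fun y : R => y `^ (-1))) => //; exact: measurable_powR.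
have mpr : measurable_fun setT (fun x => complex.Re (phase c (f x))).
  rewrite (_ : (fun _ => _) = (fun x => complex.Re (f x) *
      if c < cabs (f x) then (cabs (f x))^-1 else 0)).
    exact: measurable_funM.
  apply/funext => x; rewrite /phase; case: ifPn => _; last by rewrite mulr0.
  by rewrite complexReM /= mulr0 subr0.
have mpi : measurable_fun setT (fun x => complex.Im (phase c (f x))).
  rewrite (_ : (fun _ => _) = (fun x => complex.Im (f x) *
      if c < cabs (f x) then (cabs (f x))^-1 else 0)).
    exact: measurable_funM.
  apply/funext => x; rewrite /phase; case: ifPn => _; last by rewrite mulr0.
  by rewrite complexImM /= mulr0 add0r.
have Ip p : (\int[mu]_x ((cabs (phase c (f x))) `^ p)%:E < +oo)%E.
  apply: (@le_lt_trans _ _ (\int[mu]_x 1%:E)%E); last first.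
    by rewrite integral_cst_prob ltry.
  apply: le_integral_EFin => //.
    apply: (@measurableT_comp _ _ _ _ _ _ (fun y : R => y `^ p)) => //.
    exact: measurable_cabs.
    by move=> x _; exact: powR_ge0.
  move=> x _; rewrite cabs_phase//; case: ifPn => _; first by rewrite powR1.
  by have [->|p0] := eqVneq p 0; rewrite ?powRr0 ?powR0.
by split=> //; exact: (V_comp (phase c)).
Qed.

(* Test against the phase of [f] on the set where [f] is large. *)
Lemma plancherel_ae_bounded f b : W f -> 0 <= b ->
  (\int[muh]_(phi in S) (cabs (F f phi))%:E <= b%:E)%E ->
  {ae mu, forall x, cabs (f x) <= 4 * b}.
Proof.
move=> Wf b0 Ib.
have c0 : 0 <= 4 * b by rewrite mulr_ge0.
pose c := 4 * b; pose g x := phase c (f x).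
have [Vg g1 g2] := phase_in_Lp c0 Wf.
have Wg : W g by [].
have [Vf f2] := Wf; have /in_L2P[fr fi If2] := f2.
have mf := measurable_cabs fr fi.
have mb : measurable_fun setT (fun x => c < cabs (f x)).
  by apply: measurable_fun_ltr.
have mp : measurable_fun setT (fun x => if c < cabs (f x) then cabs (f x) else 0).
  exact: measurable_fun_guard.
have m1 : measurable_fun setT (fun x => if c < cabs (f x) then 1 else 0 : R).
  exact: measurable_fun_guard.
have [m Em] : exists m : R, 0 <= m /\
    (\int[mu]_x (if c < cabs (f x) then 1 else 0)%:E = m%:E)%E.
  have le1 : (\int[mu]_x (if c < cabs (f x) then 1 else 0)%:E <= 1%:E)%E.
    rewrite -[leRHS]integral_cst_prob.
    by apply: le_integral_EFin => // x _; case: ifPn.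
  have ge0 : (0 <= \int[mu]_x (if c < cabs (f x) then 1 else 0)%:E)%E.
    by apply: integral_ge0 => x _; rewrite lee_fin; case: ifPn.
  exists (fine (\int[mu]_x (if c < cabs (f x) then 1 else 0)%:E)).
  rewrite fine_ge0// fineK// ge0_fin_numE//.
  by apply: le_lt_trans le1 _; rewrite ltry.
have [m0 {}Em] := Em.
have Ig : (\int[mu]_x (cabs (g x))%:E = m%:E)%E.
  by rewrite -Em; apply: eq_integral => x _; rewrite cabs_phase.
have Ig2 : (\int[mu]_x (cabs (g x) ^+ 2)%:E = m%:E)%E.
  rewrite -Em; apply: eq_integral => x _; rewrite cabs_phase//.
  by case: ifPn; rewrite ?expr1n ?expr0n.
have [r [r0 Er]] : exists r : R, 0 <= r /\
    (\int[mu]_x (cabs (f x) ^+ 2)%:E = r%:E)%E.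
  exists (fine (\int[mu]_x (cabs (f x) ^+ 2)%:E)).
  have ge0 : (0 <= \int[mu]_x (cabs (f x) ^+ 2)%:E)%E.
    by apply: integral_ge0 => x _; rewrite lee_fin sqr_ge0.
  by rewrite fine_ge0// fineK// ge0_fin_numE.
have mg : measurable_fun setT (fun x => cabs (g x)).
  by case: g1 => ? ? _; exact: measurable_cabs.
(* Here m is the measure of the set where |f| > c. The cross term is twice the integral of |f| over
   that set. *)
have LHS : (\int[mu]_x (cabs (1 * g x + f x) ^+ 2)%:E =
    (r + m)%:E + 2%:E * \int[mu]_x (if c < cabs (f x) then cabs (f x) else 0)%:E)%E.
  under eq_integral do rewrite cabs_phaseD//.
  have p0 x : 0 <= (if c < cabs (f x) then cabs (f x) else 0).
    by case: ifPn => // _; exact: cabs_ge0.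
  rewrite integral_EFinD//; last 4 first.
  - by apply: measurable_funD; exact: measurable_funX.
  - exact: measurable_funM.
  - by move=> x _; rewrite addr_ge0// sqr_ge0.
  - by move=> x _; rewrite mulr_ge0.
  rewrite integral_EFinD//; last 4 first.
  - exact: measurable_funX.
  - exact: measurable_funX.
  - by move=> x _; exact: sqr_ge0.
  - by move=> x _; exact: sqr_ge0.
  by rewrite Er Ig2 (integral_EFinZ mu _ (k := 2)).
have mFf := plancherel_measurable_cabs Wf.
have mFg := plancherel_measurable_cabs Wg.
have Wfg := plancherel_lin 1 Wg Wf.
(* On the transform side the cross term is at most 2 |F g| |F f|, and |F g| <= 4 m because [g] has
   L^1 norm m. *)
have RHS : (\int[muh]_(phi in S) (cabs (F (fun x => 1 * g x + f x) phi) ^+ 2)%:E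
    <= (m + r)%:E + (8 * m * b)%:E)%E.
  apply: (@le_trans _ _ (\int[muh]_(phi in S)
     ((cabs (F g phi) ^+ 2 + cabs (F f phi) ^+ 2) + 8 * m * cabs (F f phi))%:E)%E).
    apply: ae_le_integral_EFin => //.
    - by apply: measurable_funX; exact: plancherel_measurable_cabs.
    - apply: measurable_funD; last exact: measurable_funM.
      by apply: measurable_funD; apply: measurable_funX.
    - by move=> x _; exact: sqr_ge0.
    - by move=> x _; rewrite !addr_ge0 ?sqr_ge0// !mulr_ge0// cabs_ge0.
    have := F_lin 1 Vg Vf g2 f2; have := F_bound Vg g1 g2; rewrite Ig -EFinM.
    apply: filterS2 => x Hg Hl Sx; rewrite Hl// mul1r.
    have := Hg Sx; rewrite lee_fin => {}Hg.
    have := cabsD (F g x) (F f x).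
    have := cabs_ge0 (F g x); have := cabs_ge0 (F f x).
    have := cabs_ge0 (F g x + F f x).
    set u := cabs (F g x + F f x); set y := cabs (F f x).
    move: Hg; set e := cabs (F g x) => em u0 y0 e0 ue.
    apply: (@le_trans _ _ ((e + y) ^+ 2)).
      by rewrite ler_pXn2r// nnegrE addr_ge0.
    have := ler_wpM2r y0 em; nra.
  rewrite integral_EFinD//; last 4 first.
  - by apply: measurable_funD; exact: measurable_funX.
  - exact: measurable_funM.
  - by move=> x _; rewrite addr_ge0// sqr_ge0.
  - by move=> x _; rewrite !mulr_ge0// cabs_ge0.
  rewrite integral_EFinD//; last 4 first.
  - exact: measurable_funX.
  - exact: measurable_funX.
  - by move=> x _; exact: sqr_ge0.
  - by move=> x _; exact: sqr_ge0.
  rewrite !plancherel_sqr// Er Ig2 -EFinD leeD2l//.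
  rewrite integral_EFinZ//; last 2 first.
  - by rewrite mulr_ge0.
  - by move=> x _; exact: cabs_ge0.
  by rewrite [leRHS]EFinM lee_wpmul2l// lee_fin mulr_ge0.
move: RHS; rewrite plancherel_sqr// LHS (addrC m r) leeD2lE// => H.
(* Comparing the two sides bounds the integral of |f| over {|f| > c} by 4 b m = c m, which leaves
   nothing for the excess |f| - c. *)
have {}H : (\int[mu]_x (if (c < cabs (f x))%R then (cabs (f x)) else 0)%:E <= (c * m)%:E)%E.
  have J0 : (0 <= \int[mu]_x (if (c < cabs (f x))%R then (cabs (f x)) else 0)%:E)%E.
    by apply: integral_ge0 => x _; rewrite lee_fin; case: ifPn => // _; exact: cabs_ge0.
  move: H J0; case: (\int[mu]_x _)%E => [i| |] //; last first.
    by rewrite gt0_muley// lte_fin.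
  by rewrite -EFinM !lee_fin /c => H _; lra.
have split : (\int[mu]_x (if (c < cabs (f x))%R then (cabs (f x)) else 0)%:E =
   \int[mu]_x (if (c < cabs (f x))%R then (cabs (f x)) - c else 0)%:E + (c * m)%:E)%E.
  rewrite EFinM -Em -integral_EFinZ//; last by move=> x _; case: ifPn.
  rewrite -integral_EFinD//.
  - by apply: eq_integral => x _; case: ifPn => _; rewrite ?mulr0 ?addr0// mulr1 subrK.
  - by apply: measurable_fun_guard => //; exact: measurable_funB.
  - exact: measurable_funM.
  - by move=> x _; case: ifPn => // /ltW; rewrite subr_ge0.
  - by move=> x _; case: ifPn; rewrite ?mulr0 ?mulr1.
have I0 : (\int[mu]_x `|(if (c < cabs (f x))%R then (cabs (f x)) - c else 0)%:E| = 0)%E.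
  apply/eqP; rewrite eq_le; apply/andP; split; last exact: integral_ge0.
  rewrite -(leeD2rE (x := (c * m)%:E))// add0e (le_trans _ H)// split leeD2r//.
  rewrite (eq_integral (fun x => (if c < cabs (f x) then cabs (f x) - c else 0)%:E))// => x _.
  by rewrite gee0_abs// lee_fin; case: ifPn => // /ltW; rewrite subr_ge0.
have /ae_eq_integral_abs : measurable_fun setT
    (fun x => (if c < cabs (f x) then cabs (f x) - c else 0)%:E).
  by apply/measurable_EFinP; apply: measurable_fun_guard => //; exact: measurable_funB.
move=> /(_ mu measurableT)[/(_ I0) + _]; apply: filterS => x /(_ I) /=.
rewrite leNgt; case: ifPn => // cx [] /eqP; rewrite subr_eq0 => /eqP E.
by move: cx; rewrite E ltxx.
Qed.

(* A transform equal to the indicator of [E] comes from a function bounded by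
   [4 * muh E] whose squared norm is [muh E]. *)
Lemma plancherel_measure_gap E : measurable E -> E `<=` S ->
  (muh E < +oo)%E -> muh E = 0%E \/ ((16^-1)%:E <= muh E)%E.
Proof.
move=> mE ES Efin.
pose h phi : R[i] := ((\1_E phi : R)%:C)%C.
have m1 : measurable_fun S (\1_E : T2 -> R) by exact: measurable_indic.
have ch phi : cabs (h phi) = \1_E phi by rewrite cabs_real// indicE.
have hk k : (0 < k)%N -> (\int[muh]_(phi in S) (cabs (h phi) ^+ k)%:E = muh E)%E.
  move=> k0; rewrite -[in RHS](setIidl ES) -integral_indic//.
  apply: eq_integral => phi _; rewrite ch indicE.
  by case: (_ \in _); rewrite ?expr1n// expr0n gtn_eqF.
have h2 : in_Lp muh S 2 h.
  by apply/in_L2P; split=> //=; rewrite hk.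
have [f [Vf f2 Fh]] := F_surj h2.
have Wf : W f by [].
have mFf := plancherel_measurable_cabs Wf.
have mh : measurable_fun S (fun phi => cabs (h phi)).
  by under eq_fun do rewrite ch.
have I1 : (\int[muh]_(phi in S) (cabs (F f phi))%:E = muh E)%E.
  rewrite -(hk 1%N)//; apply: ae_eq_integral_EFin => //.
  - by move=> x _; exact: cabs_ge0.
  - by move=> x _; exact: cabs_ge0.
  - by move: Fh; apply: filterS => x + Sx => ->.
have I2 : (\int[mu]_x (cabs (f x) ^+ 2)%:E = muh E)%E.
  rewrite -plancherel_sqr// -(hk 2%N)//; apply: ae_eq_integral_EFin => //.
  - exact: measurable_funX.
  - exact: measurable_funX.
  - by move=> x _; exact: sqr_ge0.
  - by move=> x _; exact: sqr_ge0.
  - by move: Fh; apply: filterS => x + Sx => ->.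
have [m [m0 Em]] : exists m : R, 0 <= m /\ muh E = m%:E.
  exists (fine (muh E)); rewrite fine_ge0// fineK// ge0_fin_numE//.
have := plancherel_ae_bounded Wf m0; rewrite I1 Em => /(_ (lexx _)) fb.
have /in_L2P[fr fi _] := f2.
(* On a space of mass one, |f| <= 4 m bounds the squared norm m by 16 m^2. *)
have : (m%:E <= (16 * m ^+ 2)%:E)%E.
  rewrite -Em -I2 -integral_cst_prob; apply: ae_le_integral_EFin => //.
  - by apply: measurable_funX; exact: measurable_cabs.
  - by move=> x _; exact: sqr_ge0.
  - by move=> x _; rewrite mulr_ge0// sqr_ge0.
  - move: fb; apply: filterS => x fb _.
    have -> : 16 * m ^+ 2 = (4 * m) ^+ 2 by ring.
    by rewrite ler_pXn2r// nnegrE ?cabs_ge0// mulr_ge0.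
rewrite lee_fin => mm; have [->|mn0] := eqVneq m 0; [by left|right].
have mp : 0 < m by rewrite lt_neqAle eq_sym mn0.
rewrite lee_fin -(ler_pM2l mp); lra.
Qed.

(** Surjectivity turns the transform cut to [b] into a function [f1], bounded through
    [plancherel_ae_bounded]. The remainder [f2] carries the rest of the transform, and the isometry
    gives its norm. *)
Lemma plancherel_tail f (b : T2 -> bool) (l : R) : W f ->
  measurable_fun S b -> 0 < l ->
  (\int[muh]_(phi in S) (if b phi then cabs (F f phi) else 0)%:E <= l%:E)%E ->
  (\int[mu]_x (if (8 * l < cabs (f x))%R then (4 * l) ^+ 2 else 0)%:E <=
   \int[muh]_(phi in S) (if b phi then 0 else cabs (F f phi) ^+ 2)%:E)%E.
Proof.
move=> Wf mb l0 Il.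
pose h phi : R[i] := if b phi then F f phi else 0.
have [mr mi] := plancherel_measurable Wf.
have mFf := plancherel_measurable_cabs Wf.
have mnb : measurable_fun S (fun phi => ~~ b phi) by exact: measurable_neg.
have ch phi : cabs (h phi) = if b phi then cabs (F f phi) else 0.
  by rewrite /h; case: ifPn => // _; exact: cabs0.
have mch : measurable_fun S (fun phi => if b phi then cabs (F f phi) else 0).
  exact: measurable_fun_guard.
have h2 : in_Lp muh S 2 h.
  apply/in_L2P; split.
  - rewrite (_ : (fun _ => _) = fun x => if b x then complex.Re (F f x) else 0).
      exact: measurable_fun_guard.
    by apply/funext => x; rewrite /h; case: ifPn.
  - rewrite (_ : (fun _ => _) = fun x => if b x then complex.Im (F f x) else 0).
      exact: measurable_fun_guard.
    by apply/funext => x; rewrite /h; case: ifPn.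
  - apply: (@le_lt_trans _ _ (\int[muh]_(phi in S) (cabs (F f phi) ^+ 2)%:E)%E).
      apply: le_integral_EFin => //.
      + by apply: measurable_funX; under eq_fun do rewrite ch.
      + exact: measurable_funX.
      + by move=> x _; exact: sqr_ge0.
      + move=> x _; rewrite ch; case: ifPn => // _; rewrite expr0n/=.
        exact: sqr_ge0.
    by rewrite plancherel_sqr//; have [_ /in_L2P[]] := Wf.
have [f1 [Vf1 f12 Fh]] := F_surj h2.
have Wf1 : W f1 by [].
have Wf2 := plancherel_lin (-1) Wf1 Wf.
set f2 := (fun _ => _) in Wf2.
have f1b : {ae mu, forall x, cabs (f1 x) <= 4 * l}.
  apply: (plancherel_ae_bounded Wf1); first exact: ltW.
  apply: le_trans Il; rewrite le_eqVlt; apply/orP; left; apply/eqP.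
  apply: ae_eq_integral_EFin => //.
  - exact: plancherel_measurable_cabs.
  - by move=> x _; exact: cabs_ge0.
  - by move=> x _; case: ifPn => // _; exact: cabs_ge0.
  - by move: Fh; apply: filterS => x + Sx => ->//; rewrite ch.
have [_ /in_L2P[fr fi _]] := Wf.
have mf := measurable_cabs fr fi.
have -> : (\int[muh]_(phi in S) (if b phi then 0 else cabs (F f phi) ^+ 2)%:E =
           \int[mu]_x (cabs (f2 x) ^+ 2)%:E)%E.
  rewrite -plancherel_sqr//; apply: ae_eq_integral_EFin => //.
  - apply: measurable_fun_if => //.
    by apply: measurable_funS (measurable_funX 2 mFf).
  - by apply: measurable_funX; exact: plancherel_measurable_cabs.
  - by move=> x _; case: ifPn => // _; exact: sqr_ge0.
  - by move=> x _; exact: sqr_ge0.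
  have := F_lin (-1) Vf1 Wf.1 f12 Wf.2.
  move: Fh; apply: filterS2 => x Fh Fl Sx; rewrite Fl// Fh// /h.
  case: ifPn => _; first by rewrite mulN1r addNr cabs0 expr0n.
  by rewrite mulr0 add0r.
have [_ /in_L2P[f2r f2i _]] := Wf2.
have mf2 := measurable_cabs f2r f2i.
apply: ae_le_integral_EFin => //.
- by apply: measurable_fun_guard => //; apply: measurable_fun_ltr.
- exact: measurable_funX.
- by move=> x _; case: ifPn => // _; exact: sqr_ge0.
- by move=> x _; exact: sqr_ge0.
move: f1b; apply: filterS => x f1b _; case: ifPn => [fx|_]; last exact: sqr_ge0.
rewrite ler_pXn2r ?nnegrE ?cabs_ge0 ?mulr_ge0 ?(ltW l0)//.
have := cabsD (f1 x) (f2 x).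
rewrite /f2 mulN1r addrA subrr add0r; lra.
Qed.

(** * Continuous and compact embedding for an abstract transform *)

Section Embedding.
Variables alpha s : R.
Hypotheses (s0 : 0 < s) (sa : s < alpha).

(** Stated for an arbitrary positive weight because [small_norm] applies it to a rescaled one. The
    factor 3 survives the q-th root since 3^(1/q) <= 3. *)
Lemma plancherel_embedding (w : T2 -> R) (N B : R) f q : measurable_fun S w -> (forall phi, S phi -> 0 < w phi) ->
  0 < N -> 0 < B -> W f ->
  (\int[muh]_(phi in S) (w phi `^ (- alpha))%:E <= B%:E)%E ->
  (\int[muh]_(phi in S) (w phi `^ s * cabs (F f phi) ^+ 2)%:E <= (N ^+ 2)%:E)%E ->
  1 <= q <= 2 * alpha / (alpha - s) ->
  in_Lp mu setT q f /\
  Lp_norm mu setT q f <=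
    3 * (embedding_const alpha s `^ (2 * alpha / (alpha - s))^-1 *
         (N * B `^ (s / (2 * alpha)))).
Proof.
move=> mw w0 N0 B0 Wf IB IN q1p; have [_ /in_L2P[fr fi _]] := Wf.
have := weighted_embedding_Lq mu1 mS (measurable_cabs fr fi)
  (fun x => cabs_ge0 (f x)) (plancherel_measurable_cabs Wf)
  (fun phi => cabs_ge0 (F f phi)) mw w0 s0 sa N0 B0
  (fun b l => @plancherel_tail f b l Wf) IB IN q1p.
set t := (X in (_ <= (3 * X `^ q)%:E)%E) => It.
have t0 : 0 <= t by rewrite !mulr_ge0 ?powR_ge0// ltW.
have /andP[q1 _] := q1p.
have q0 : 0 < q by apply: lt_le_trans q1.
have I0 : (0 <= \int[mu]_x (cabs (f x) `^ q)%:E)%E.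
  by apply: integral_ge0 => x _; rewrite lee_fin powR_ge0.
have Ifin : (\int[mu]_x (cabs (f x) `^ q)%:E < +oo)%E.
  by apply: le_lt_trans It _; rewrite ltry.
split; first by split.
rewrite /Lp_norm /Rintegral.
have rI : fine (\int[mu]_x (cabs (f x) `^ q)%:E) <= 3 * t `^ q.
  by rewrite -lee_fin fineK// ge0_fin_numE.
apply: (@le_trans _ _ ((3 * t `^ q) `^ q^-1)).
  apply: ge0_ler_powR; rewrite ?nnegrE ?invr_ge0 ?(ltW q0) ?fine_ge0//.
  by rewrite mulr_ge0 ?powR_ge0.
rewrite powRM ?powR_ge0// -powRrM mulfV ?gt_eqF// powRr1//.
rewrite ler_wpM2r//; apply: ler1_powR; first by rewrite ler1n.
by rewrite invf_le1.
Qed.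

Variable w : T2 -> R.
Hypothesis mw : measurable_fun S w.
Hypothesis w1 : forall phi, S phi -> 1 <= w phi.
Hypothesis Iw : (\int[muh]_(phi in S) (w phi `^ (- alpha))%:E < +oo)%E.

Let energy f := (\int[muh]_(phi in S) (w phi `^ s * cabs (F f phi) ^+ 2)%:E)%E.

Let w0 phi : S phi -> 0 < w phi.
Proof. by move=> /w1; exact: lt_le_trans. Qed.

Let a0 : 0 < alpha. Proof. exact: lt_trans sa. Qed.

Let B0 := fine (\int[muh]_(phi in S) (w phi `^ (- alpha))%:E).

Let Iw_ge0 : (0 <= \int[muh]_(phi in S) (w phi `^ (- alpha))%:E)%E.
Proof. by apply: integral_ge0 => phi _; rewrite lee_fin powR_ge0. Qed.

Let IwE : (\int[muh]_(phi in S) (w phi `^ (- alpha))%:E)%E = B0%:E.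
Proof. by rewrite fineK// ge0_fin_numE. Qed.

Let B0_ge0 : 0 <= B0. Proof. exact: fine_ge0. Qed.

Let energy_ge0 f : (0 <= energy f)%E.
Proof.
by apply: integral_ge0 => phi _; rewrite lee_fin mulr_ge0 ?powR_ge0 ?sqr_ge0.
Qed.

Let const_gt0 : 0 < embedding_const alpha s `^ (2 * alpha / (alpha - s))^-1.
Proof. by apply: powR_gt0; exact: embedding_const_gt0. Qed.

Theorem plancherel_continuous_embedding q : 1 <= q <= 2 * alpha / (alpha - s) ->
  exists C : R, forall f, W f -> (energy f < +oo)%E ->
    in_Lp mu setT q f /\ Lp_norm mu setT q f <= C * (fine (energy f)) `^ 2^-1.
Proof.
move=> q1p.
exists (3 * (embedding_const alpha s `^ (2 * alpha / (alpha - s))^-1 *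
   (B0 + 1) `^ (s / (2 * alpha)))) => f Wf ef.
set K := 3 * _.
have K0 : 0 < K by rewrite !mulr_gt0// powR_gt0// ltr_wpDl.
set n := fine (energy f) `^ 2^-1.
have n0 : 0 <= n by exact: powR_ge0.
(* [plancherel_embedding] asks for positive bounds: 1 is added to [B0], and the norm is raised by an
   [e] that then tends to 0. *)
have ne (e : R) : 0 < e -> in_Lp mu setT q f /\ Lp_norm mu setT q f <= K * (n + e).
  move=> e0.
  have ne0 : 0 < n + e by rewrite ltr_wpDl.
  have B1 : 0 < B0 + 1 by rewrite ltr_wpDl.
  have -> : K * (n + e) =
      3 * (embedding_const alpha s `^ (2 * alpha / (alpha - s))^-1 *
           ((n + e) * (B0 + 1) `^ (s / (2 * alpha)))) by rewrite /K; ring.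
  apply: (plancherel_embedding mw w0 ne0 B1 Wf) => //.
    by rewrite IwE lee_fin lerDl.
  apply: (@le_trans _ _ (n ^+ 2)%:E); last first.
    by rewrite lee_fin ler_pXn2r ?nnegrE ?(ltW ne0)// lerDl ltW.
  rewrite /n -powR_mulrn ?powR_ge0// -powRrM mulVf ?pnatr_eq0//.
  by rewrite powRr1 ?fine_ge0// fineK// ge0_fin_numE.
split; first by have [] := ne 1 ltr01.
apply/ler_addgt0Pr => e e0.
have [|_] := ne (e / K); first by rewrite divr_gt0.
by rewrite mulrDr mulrCA divff ?gt_eqF// mulr1.
Qed.

Let lvl (j : nat) := S `&` [set phi | w phi <= j%:R].

Let mlvlb (j : nat) : measurable_fun S (fun phi => w phi <= j%:R).
Proof. exact: measurable_fun_ler. Qed.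

Let mlvl j : measurable (lvl j).
Proof. exact: (measurable_setI_bool mS (mlvlb j)). Qed.

Let mpow (h : T2 -> R) r : measurable_fun S h -> measurable_fun S (fun phi => h phi `^ r).
Proof.
move=> mh; exact: (@measurableT_comp _ _ _ _ _ _ (fun z : R => z `^ r)).
Qed.

Let lvl_fin j : (muh (lvl j) < +oo)%E.
Proof.
(* Chebyshev's inequality; j + 1 instead of j keeps [c] positive at j = 0, where the power would be
   0. *)
pose c : R := j.+1%:R `^ (- alpha).
have c0 : 0 < c by rewrite powR_gt0.
have : (c%:E * muh (lvl j) <= B0%:E)%E.
  rewrite -integral_cst// -IwE.
  apply: (@le_trans _ _ (\int[muh]_(phi in lvl j) (w phi `^ (- alpha))%:E)%E).
    apply: (@le_integral_EFin _ _ _ _ _ _ (fun=> c)) => //.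
    - by apply: measurable_funS (mpow (- alpha) mw) => //; exact: subIsetl.
    - by move=> phi _; exact: ltW.
    - move=> phi [Sphi wj]; rewrite /c !powRN lef_pV2 ?posrE ?powR_gt0 ?w0//.
      apply: ge0_ler_powR; rewrite ?nnegrE ?(ltW a0) ?(ltW (w0 Sphi))//.
      by apply: le_trans wj _; rewrite ler_nat.
  apply: ge0_subset_integral => //; last exact: subIsetl.
  - by apply/measurable_EFinP; exact: mpow.
  - by move=> phi _; rewrite lee_fin powR_ge0.
by case: (muh _) => [r _|/=|//]; rewrite ?ltry// gt0_muley ?lte_fin.
Qed.

(** Dominated convergence: at each point of [S] the integrand vanishes once j exceeds the weight. *)
Let high_frequency (e : R) : 0 < e -> exists j : nat,
  (\int[muh]_(phi in S) (if (w phi <= j%:R)%R then 0 else w phi `^ (- alpha))%:E <= e%:E)%E.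
Proof.
move=> e0.
pose g (j : nat) phi := (if w phi <= j%:R then 0 else w phi `^ (- alpha))%:E.
have mg0 j : measurable_fun S (fun phi => if w phi <= j%:R then 0 else w phi `^ (- alpha)).
  apply: measurable_fun_if => //.
  by apply: measurable_funS (mpow (- alpha) mw).
have mg j : measurable_fun S (g j) by apply/measurable_EFinP; exact: mg0.
have mwa : measurable_fun S (fun phi => (w phi `^ (- alpha))%:E).
  by apply/measurable_EFinP; exact: mpow.
have Ig : muh.-integrable S (fun phi => (w phi `^ (- alpha))%:E).
  apply/integrableP; split=> //.
  apply: le_lt_trans Iw; rewrite le_eqVlt; apply/orP; left; apply/eqP.
  by apply: eq_integral => phi _; rewrite gee0_abs// lee_fin powR_ge0.
have cvg_g phi : S phi -> g^~ phi @ \oo --> cst 0%E phi.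
  move=> Sphi; apply: cvg_near_cst.
  exists (Num.bound (w phi)) => // j /= bj; rewrite /g.
  have -> : w phi <= j%:R; last by [].
  apply: le_trans (ltW (archi_boundP (ltW (w0 Sphi)))) _.
  by rewrite ler_nat.
have gle j phi : S phi -> (`|g j phi| <= (w phi `^ (- alpha))%:E)%E.
  by move=> _; rewrite /g; case: ifPn => _; rewrite ?abse0 ?gee0_abs// lee_fin powR_ge0.
have fing phi : S phi -> (w phi `^ (- alpha))%:E \is a fin_num by [].
have := dominated_cvg mS mg cvg_g fing Ig gle.
rewrite integral0 => /fine_cvgP[_ /cvgrPdist_le/(_ e e0)[j _ /(_ j (leqnn j)) /= hj]].
exists j.
have I0 : (0 <= \int[muh]_(phi in S) g j phi)%E.
  by apply: integral_ge0 => phi _; rewrite /g lee_fin; case: ifPn => // _; exact: powR_ge0.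
have Ifin : (\int[muh]_(phi in S) g j phi)%E \is a fin_num.
  rewrite ge0_fin_numE//; apply: le_lt_trans Iw.
  apply: (@le_integral_EFin _ _ _ _ _ _ _ (fun phi => w phi `^ (- alpha))) => //.
  - exact: mpow.
  - by move=> phi _; case: ifPn => // _; exact: powR_ge0.
  - by move=> phi _; case: ifPn => // _; exact: powR_ge0.
rewrite -/(g j) -(fineK Ifin) lee_fin.
by move: hj; rewrite sub0r normrN ger0_norm// fine_ge0.
Qed.

Let pow_lvl j phi : lvl j phi -> w phi `^ s <= j%:R `^ s.
Proof.
move=> [Sphi wj]; apply: ge0_ler_powR; rewrite ?nnegrE ?(ltW s0)//.
exact: ltW (w0 Sphi).
Qed.

Let inv_small (K e : R) : 0 <= K -> 0 < e ->
  exists k0 : nat, forall k, (k0 <= k)%N -> K * (2 / k.+1%:R) ^+ 2 <= e.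
Proof.
move=> K0 e0; exists (Num.bound (4 * K / e)) => k bk.
have k0 : 0 < k.+1%:R :> R by [].
have k1 : 1 <= k.+1%:R :> R by rewrite ler1n.
have : 4 * K / e < k.+1%:R.
  apply: lt_le_trans (archi_boundP _) _; last by rewrite ler_nat leqW.
  by rewrite divr_ge0 ?(ltW e0)// mulr_ge0.
rewrite ltr_pdivrMr// => H.
have -> : K * (2 / k.+1%:R) ^+ 2 = 4 * K / k.+1%:R / k.+1%:R.
  by field; rewrite gt_eqF.
rewrite ler_pdivrMr// ler_pdivrMr//.
by move: H k1 k0; set x := k.+1%:R; nra.
Qed.

(** A Fatou-type bound, proved on each [lvl j] and passed to the union. On one level, of finite
    measure, the error is at most 1 for k large; the 2 is that of (a + b)^2 <= 2 a^2 + 2 b^2. *)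
Let weighted_limit (H : nat -> T2 -> R[i]) (h : T2 -> R[i]) (M : R) :
  (forall n, measurable_fun S (fun phi => cabs (H n phi))) ->
  measurable_fun S (fun phi => cabs (h phi)) ->
  (forall n, (\int[muh]_(phi in S) (w phi `^ s * cabs (H n phi) ^+ 2)%:E <= M%:E)%E) ->
  (forall j k : nat, (j <= k)%N -> {ae muh, forall phi, S phi -> w phi <= j%:R ->
     cabs (H k phi - h phi) <= 2 / k.+1%:R}) ->
  (\int[muh]_(phi in S) (w phi `^ s * cabs (h phi) ^+ 2)%:E <= (2 * M + 1)%:E)%E.
Proof.
move=> mH mh HM Hh.
have mwh (y : T2 -> R) : measurable_fun S y ->
    measurable_fun S (fun phi => w phi `^ s * y phi ^+ 2).
  by move=> my; apply: measurable_funM; [exact: mpow|exact: measurable_funX].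
have wh0 (y : T2 -> R) phi : 0 <= w phi `^ s * y phi ^+ 2.
  by rewrite mulr_ge0 ?powR_ge0 ?sqr_ge0.
have bound j : (\int[muh]_(phi in lvl j) (w phi `^ s * cabs (h phi) ^+ 2)%:E
    <= (2 * M + 1)%:E)%E.
  have Ef : muh (lvl j) \is a fin_num by rewrite ge0_fin_numE.
  have K0 : 0 <= 2 * j%:R `^ s * fine (muh (lvl j)).
    by rewrite !mulr_ge0 ?powR_ge0// fine_ge0.
  have [k0 /(_ (maxn k0 j) (leq_maxl _ _))] := inv_small K0 ltr01.
  set k := maxn k0 j => Kk.
  have jk : (j <= k)%N by exact: leq_maxr.
  have sub : lvl j `<=` S by exact: subIsetl.
  have mHk : measurable_fun (lvl j) (fun phi => 2 * (w phi `^ s * cabs (H k phi) ^+ 2)).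
    by apply: measurable_funM => //; apply: measurable_funS (mwh _ (mH k)).
  apply: (@le_trans _ _ (\int[muh]_(phi in lvl j)
      (2 * (w phi `^ s * cabs (H k phi) ^+ 2) +
       2 * j%:R `^ s * (2 / k.+1%:R) ^+ 2)%:E)%E).
    apply: ae_le_integral_EFin => //.
    - by apply: measurable_funS (mwh _ mh).
    - exact: measurable_funD.
    - by move=> phi _; exact: (wh0 (fun phi => cabs (h phi))).
    - move=> phi _; apply: addr_ge0; last first.
        by rewrite mulr_ge0 ?sqr_ge0// mulr_ge0 ?powR_ge0.
      by rewrite mulr_ge0//; exact: (wh0 (fun phi => cabs (H k phi))).
    apply: filterS (Hh j k jk) => phi + lphi; have [Sphi wj] := lphi.
    move=> /(_ Sphi wj); set c := 2 / _ => hc.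
    have c0 : 0 <= c by rewrite divr_ge0.
    have wlj := pow_lvl lphi.
    have ws0 := powR_ge0 (w phi) s.
    have H1 : cabs (h phi) <= cabs (H k phi) + c.
      have := cabsD (H k phi) (- (H k phi - h phi)).
      have -> : H k phi + - (H k phi - h phi) = h phi by ring.
      move=> /le_trans; apply; rewrite lerD2l.
      by rewrite -mulN1r cabsM cabsN1 mul1r.
    have H2 : cabs (h phi) ^+ 2 <= 2 * cabs (H k phi) ^+ 2 + 2 * c ^+ 2.
      apply: (@le_trans _ _ ((cabs (H k phi) + c) ^+ 2)).
        by rewrite ler_pXn2r ?nnegrE ?addr_ge0 ?cabs_ge0.
      have := sqr_ge0 (cabs (H k phi) - c); nra.
    apply: le_trans (ler_wpM2l ws0 H2) _.
    have := ler_wpM2r (sqr_ge0 c) wlj; lra.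
  have nn1 phi : lvl j phi -> 0 <= 2 * (w phi `^ s * cabs (H k phi) ^+ 2).
    by move=> _; rewrite mulr_ge0//; exact: (wh0 (fun phi => cabs (H k phi))).
  have nn2 phi : lvl j phi -> 0 <= 2 * j%:R `^ s * (2 / k.+1%:R) ^+ 2.
    by move=> _; rewrite mulr_ge0 ?sqr_ge0// mulr_ge0 ?powR_ge0.
  rewrite (integral_EFinD muh (mlvl j) mHk _ nn1 nn2)//.
  rewrite EFinD leeD//.
    have mHk0 : measurable_fun (lvl j) (fun phi => w phi `^ s * cabs (H k phi) ^+ 2).
      by apply: measurable_funS (mwh _ (mH k)).
    rewrite (integral_EFinZ muh (mlvl j) _ mHk0)//; last first.
      by move=> phi _; exact: (wh0 (fun phi => cabs (H k phi))).
    rewrite EFinM lee_wpmul2l// ?lee_fin//.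
    apply: le_trans (HM k); apply: ge0_subset_integral => //.
    - by apply/measurable_EFinP; exact: mwh.
    - by move=> phi _; rewrite lee_fin; exact: (wh0 (fun phi => cabs (H k phi))).
  rewrite integral_cst// -(fineK Ef) -EFinM lee_fin.
  by move: Kk; rewrite mulrAC.
have -> : S = \bigcup_j lvl j.
  apply/seteqP; split=> [phi Sphi|phi [j _ []]//].
  exists (Num.bound (w phi)) => //; split=> //=.
  exact: ltW (archi_boundP (ltW (w0 Sphi))).
have cvgI : (\int[muh]_(phi in lvl j) (w phi `^ s * cabs (h phi) ^+ 2)%:E @[j --> \oo] -->
   \int[muh]_(phi in \bigcup_j lvl j) (w phi `^ s * cabs (h phi) ^+ 2)%:E)%E.
  apply: ge0_nondecreasing_set_cvg_integral => //.
  - move=> n m nm; apply/subsetPset => phi [Sphi wn]; split=> //=.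
    by apply: le_trans wn _; rewrite ler_nat.
  - move=> j; apply/measurable_EFinP.
    by apply: measurable_funS (mwh _ mh) => //; exact: subIsetl.
  - by move=> j phi _; rewrite lee_fin; exact: (wh0 (fun phi => cabs (h phi))).
rewrite -(cvg_lim _ cvgI)//; apply: lime_le; first by apply/cvg_ex; eexists; exact: cvgI.
exact: nearW.
Qed.

Let energy_sub (f g : T1 -> R[i]) (A A' : R) : W f -> W g ->
  (energy f <= A%:E)%E -> (energy g <= A'%:E)%E ->
  (energy (fun x => -1 * g x + f x)%R <= (2 * A' + 2 * A)%:E)%E.
Proof.
move=> Wf Wg fA gA'.
have mwF (u : T1 -> R[i]) : W u ->
    measurable_fun S (fun phi => w phi `^ s * cabs (F u phi) ^+ 2).
  move=> Wu; apply: measurable_funM; first exact: mpow.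
  by apply: measurable_funX; exact: plancherel_measurable_cabs.
have wF0 (u : T1 -> R[i]) phi : S phi -> 0 <= w phi `^ s * cabs (F u phi) ^+ 2.
  by move=> _; rewrite mulr_ge0 ?powR_ge0 ?sqr_ge0.
have m2 (u : T1 -> R[i]) : W u ->
    measurable_fun S (fun phi => 2 * (w phi `^ s * cabs (F u phi) ^+ 2)).
  by move=> /mwF mu2; exact: measurable_funM.
have n2 (u : T1 -> R[i]) phi : S phi -> 0 <= 2 * (w phi `^ s * cabs (F u phi) ^+ 2).
  by move=> Sphi; rewrite mulr_ge0// wF0.
apply: (@le_trans _ _ (\int[muh]_(phi in S)
   (2 * (w phi `^ s * cabs (F g phi) ^+ 2) +
    2 * (w phi `^ s * cabs (F f phi) ^+ 2))%:E)%E).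
  apply: ae_le_integral_EFin => //.
  - exact: mwF (plancherel_lin _ Wg Wf).
  - by apply: measurable_funD; exact: m2.
  - exact: wF0.
  - by move=> phi Sphi; rewrite addr_ge0 ?n2.
  apply: filterS (F_lin (-1) Wg.1 Wf.1 Wg.2 Wf.2) => phi + Sphi => ->//.
  have := cabsD (-1 * F g phi) (F f phi).
  rewrite cabsM cabsN1 mul1r.
  have := cabs_ge0 (F g phi); have := cabs_ge0 (F f phi).
  have := cabs_ge0 (-1 * F g phi + F f phi); have := powR_ge0 (w phi) s.
  set z := cabs (-1 * _ + _); set x := cabs (F g phi); set y := cabs (F f phi).
  set v := w phi `^ s => v0 z0 y0 x0 zxy.
  have : z ^+ 2 <= 2 * x ^+ 2 + 2 * y ^+ 2.
    apply: (@le_trans _ _ ((x + y) ^+ 2)).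
      by rewrite ler_pXn2r ?nnegrE ?addr_ge0.
    have := sqr_ge0 (x - y); nra.
  by move=> /(ler_wpM2l v0)/le_trans; apply; rewrite le_eqVlt; apply/orP; left; apply/eqP; ring.
rewrite (integral_EFinD muh mS (m2 _ Wg) (m2 _ Wf) (n2 g) (n2 f)).
rewrite (integral_EFinZ muh mS _ (mwF _ Wg) (wF0 g))//.
rewrite (integral_EFinZ muh mS _ (mwF _ Wf) (wF0 f))//.
apply: (@le_trans _ _ (2%:E * A'%:E + 2%:E * A%:E)%E); last first.
  by rewrite -!EFinM -EFinD.
by apply: leeD; apply: lee_wpmul2l => //; rewrite lee_fin.
Qed.

(* The weight is multiplied by [tau] on the low frequencies [w <= j]: this
   makes the integral of its power [- alpha] small, at a cost that vanishes
   when the low frequencies of [f] converge to zero. *)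
Let small_norm (q e A : R) : 1 <= q <= 2 * alpha / (alpha - s) ->
  0 < e -> 0 <= A -> exists (j k0 : nat), forall (f : T1 -> R[i]) (k : nat),
  (k0 <= k)%N -> W f -> (energy f <= A%:E)%E ->
  {ae muh, forall phi, S phi -> w phi <= j%:R ->
     cabs (F f phi) <= 2 / k.+1%:R} ->
  Lp_norm mu setT q f <= e.
Proof.
move=> q1p e0 A0.
(* Order of choices: [B] makes the embedding bound equal to [e]; [j] leaves half of [B] to the high
   frequencies; [tau] fits the low ones into the other half; [k0] limits the added energy to 1, and
   A + 1 <= N^2. *)
pose N := A + 1; have N0 : 0 < N by rewrite ltr_wpDl.
pose c := 3 * embedding_const alpha s `^ (2 * alpha / (alpha - s))^-1 * N.
have c0 : 0 < c by rewrite !mulr_gt0.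
pose B := (e / c) `^ (2 * alpha / s).
have B_gt0 : 0 < B by rewrite powR_gt0// divr_gt0.
have cB : c * B `^ (s / (2 * alpha)) = e.
  rewrite /B -powRrM (_ : 2 * alpha / s * (s / (2 * alpha)) = 1); last first.
    by field; rewrite !gt_eqF.
  by rewrite powRr1 ?divr_ge0 ?(ltW e0) ?(ltW c0)// mulrC divfK ?gt_eqF.
have B2 : 0 < B / 2 by rewrite divr_gt0.
have [j jP] := high_frequency B2.
pose tau := (B / 2 / (B0 + 1)) `^ (- alpha^-1).
have B01 : 0 < B0 + 1 by rewrite ltr_wpDl.
have BB : 0 < B / 2 / (B0 + 1) by rewrite divr_gt0.
have tau0 : 0 < tau by rewrite powR_gt0.
have tauE : tau `^ (- alpha) = B / 2 / (B0 + 1).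
  by rewrite /tau -powRrM mulrNN mulVf ?gt_eqF// powRr1// ltW.
pose K := tau `^ s * j%:R `^ s * fine (muh (lvl j)).
have K0 : 0 <= K by rewrite !mulr_ge0 ?powR_ge0// fine_ge0.
have [k0 k0P] := inv_small K0 ltr01.
exists j, k0 => f k k0k Wf fA Ff.
pose w' phi := if w phi <= j%:R then tau * w phi else w phi.
have mw' : measurable_fun S w'.
  apply: measurable_fun_if => //.
    by apply: measurable_funM => //; apply: measurable_funS mw.
  by apply: measurable_funS mw.
have w'0 phi : S phi -> 0 < w' phi.
  by move=> Sphi; rewrite /w'; case: ifPn => _; rewrite ?mulr_gt0// w0.
have mwa := mpow (- alpha) mw.
have IB : (\int[muh]_(phi in S) (w' phi `^ (- alpha))%:E <= B%:E)%E.
  have mhigh : measurable_fun S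
      (fun phi => if w phi <= j%:R then 0 else w phi `^ (- alpha)).
    by apply: measurable_fun_if => //; apply: measurable_funS mwa.
  have nhigh phi : S phi -> 0 <= (if w phi <= j%:R then 0 else w phi `^ (- alpha)).
    by move=> _; case: ifPn => // _; exact: powR_ge0.
  have mlow : measurable_fun S (fun phi => tau `^ (- alpha) * w phi `^ (- alpha)).
    exact: measurable_funM.
  have nlow phi : S phi -> 0 <= tau `^ (- alpha) * w phi `^ (- alpha).
    by move=> _; rewrite mulr_ge0 ?powR_ge0.
  apply: (@le_trans _ _ (\int[muh]_(phi in S)
    (tau `^ (- alpha) * w phi `^ (- alpha) +
     if (w phi <= j%:R)%R then 0 else w phi `^ (- alpha))%:E)%E).
    apply: le_integral_EFin => //.
    - exact: mpow.
    - exact: measurable_funD.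
    - by move=> phi _; exact: powR_ge0.
    - move=> phi Sphi; rewrite /w'; case: ifPn => _.
        by rewrite addr0 powRM// ltW// w0.
      by rewrite lerDr nlow.
  rewrite (integral_EFinD muh mS mlow mhigh nlow nhigh).
  have nwa phi : S phi -> 0 <= w phi `^ (- alpha) by move=> _; exact: powR_ge0.
  rewrite (integral_EFinZ muh mS (powR_ge0 tau _) mwa nwa) IwE tauE.
  rewrite (_ : B%:E = (B / 2)%:E + (B / 2)%:E)%E; last first.
    by rewrite -EFinD -splitr.
  apply: leeD => //.
  rewrite -EFinM lee_fin mulrAC ler_pdivrMr//.
  by rewrite ler_wpM2l ?(ltW B2)// lerDl.
have mFf := plancherel_measurable_cabs Wf.
have IN : (\int[muh]_(phi in S) (w' phi `^ s * cabs (F f phi) ^+ 2)%:E <= (N ^+ 2)%:E)%E.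
  pose cst := tau `^ s * j%:R `^ s * (2 / k.+1%:R) ^+ 2.
  have cst0 : 0 <= cst by rewrite mulr_ge0 ?sqr_ge0// mulr_ge0 ?powR_ge0.
  have mlow : measurable_fun S (fun phi => if w phi <= j%:R then cst else 0).
    exact: measurable_fun_guard.
  have nlow phi : S phi -> 0 <= (if w phi <= j%:R then cst else 0).
    by move=> _; case: ifPn.
  have mwF : measurable_fun S (fun phi => w phi `^ s * cabs (F f phi) ^+ 2).
    by apply: measurable_funM; [exact: mpow|exact: measurable_funX].
  have nwF phi : S phi -> 0 <= w phi `^ s * cabs (F f phi) ^+ 2.
    by move=> _; rewrite mulr_ge0 ?powR_ge0 ?sqr_ge0.
  apply: (@le_trans _ _ (\int[muh]_(phi in S)
    (w phi `^ s * cabs (F f phi) ^+ 2 + if (w phi <= j%:R)%R then cst else 0)%:E)%E).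
    apply: ae_le_integral_EFin => //.
    - by apply: measurable_funM; [exact: mpow|exact: measurable_funX].
    - exact: measurable_funD.
    - by move=> phi _; rewrite mulr_ge0 ?powR_ge0 ?sqr_ge0.
    - by move=> phi Sphi; rewrite addr_ge0 ?nwF ?nlow.
    apply: filterS Ff => phi Ff Sphi; rewrite /w'; case: ifPn => [wj|_]; last by rewrite addr0.
    rewrite -[leLHS]add0r lerD ?nwF//.
    rewrite powRM ?(ltW tau0) ?(ltW (w0 Sphi))// /cst.
    have l1 : tau `^ s * w phi `^ s <= tau `^ s * j%:R `^ s.
      by apply: ler_wpM2l; [exact: powR_ge0|exact: pow_lvl].
    apply: ler_pM => //; [by rewrite mulr_ge0 ?powR_ge0|exact: sqr_ge0|].
    by rewrite ler_pXn2r ?nnegrE ?cabs_ge0 ?divr_ge0//; exact: Ff.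
  rewrite (integral_EFinD muh mS mwF mlow nwF nlow).
  apply: (@le_trans _ _ (A%:E + 1%:E)%E); last first.
    by rewrite -EFinD lee_fin -/N expr2 ler_peMr ?(ltW N0)// /N lerDr.
  apply: leeD => //.
  rewrite (integral_if muh (fun phi => w phi <= j%:R) (fun=> cst)).
  have Ef : muh (lvl j) \is a fin_num by rewrite ge0_fin_numE.
  rewrite integral_cst//; last exact: mlvl.
  rewrite (_ : S `&` _ = lvl j)// -(fineK Ef) -EFinM lee_fin.
  by have := k0P k k0k; rewrite /K /cst mulrAC.
have [_] := plancherel_embedding mw' w'0 N0 B_gt0 Wf IB IN q1p.
move=> /le_trans; apply; rewrite -cB /c.
by rewrite le_eqVlt; apply/orP; left; apply/eqP; ring.
Qed.

(** The limit is built on the transform side and pulled back by [F_surj]. Its energy is finite by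
    [weighted_limit], so the differences from the limit have a common energy bound and [small_norm]
    applies to them. *)
Theorem plancherel_compact_embedding (q : R) (u : nat -> T1 -> R[i]) (M : R) :
  1 <= q <= 2 * alpha / (alpha - s) ->
  (forall n, W (u n) /\ (energy (u n) <= M%:E)%E) ->
  exists sigma : nat -> nat, (forall n, (sigma n < sigma n.+1)%N) /\
  exists g : T1 -> R[i], [/\ V g, in_Lp mu setT q g &
    (fun n => Lp_norm mu setT q (fun x => u (sigma n) x - g x)) @ \oo --> (0 : R)].
Proof.
move=> q1p uM.
have M0 : 0 <= M by rewrite -lee_fin; apply: le_trans (uM 0%N).2.
have Wu n : W (u n) := (uM n).1.
have le_energy (v : T2 -> R) : measurable_fun S v ->
    (\int[muh]_(phi in S) (v phi ^+ 2)%:E <=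
     \int[muh]_(phi in S) (w phi `^ s * v phi ^+ 2)%:E)%E.
  move=> mv; apply: le_integral_EFin => //.
  - exact: measurable_funX.
  - by apply: measurable_funM; [exact: mpow|exact: measurable_funX].
  - by move=> phi _; exact: sqr_ge0.
  - move=> phi Sphi; rewrite ler_peMl ?sqr_ge0//.
    have := ge0_ler_powR (ltW s0); move=> /(_ 1 (w phi)); rewrite powR1; apply.
    + by rewrite nnegrE.
    + by rewrite nnegrE ltW// w0.
    + exact: w1.
have [U [UU ooU]] := @ultraFilterLemma _ \oo _.
have HM n : (\int[muh]_(phi in S) (cabs (F (u n) phi) ^+ 2)%:E <= M%:E)%E.
  apply: le_trans (uM n).2; apply: le_energy; exact: plancherel_measurable_cabs.
have kappa0 : 0 < 16^-1 :> R by rewrite invr_gt0.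
have [sigma [h [sigma_incr hr hi hP]]] := gap_subsequence mS kappa0
  plancherel_measure_gap ooU mw lvl_fin
  (fun n => (plancherel_measurable (Wu n)).1)
  (fun n => (plancherel_measurable (Wu n)).2) HM.
have mh := measurable_cabs hr hi.
have Ih : (\int[muh]_(phi in S) (w phi `^ s * cabs (h phi) ^+ 2)%:E <= (2 * M + 1)%:E)%E.
  apply: (weighted_limit (H := fun k => F (u (sigma k)))) => //.
  - by move=> n; exact: plancherel_measurable_cabs.
  - by move=> n; exact: (uM (sigma n)).2.
have h2 : in_Lp muh S 2 h.
  apply/in_L2P; split=> //; apply: le_lt_trans (le_energy _ mh) _.
  by apply: le_lt_trans Ih _; rewrite ltry.
have [g [Vg g2 Fg]] := F_surj h2.
have Wg : W g by [].
have mFg := plancherel_measurable_cabs Wg.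
have Eg : (energy g <= (2 * M + 1)%:E)%E.
  apply: le_trans Ih; rewrite /energy le_eqVlt; apply/orP; left; apply/eqP.
  apply: ae_eq_integral_EFin => //.
  - by apply: measurable_funM; [exact: mpow|exact: measurable_funX].
  - by apply: measurable_funM; [exact: mpow|exact: measurable_funX].
  - by move=> phi _; rewrite mulr_ge0 ?powR_ge0 ?sqr_ge0.
  - by move=> phi _; rewrite mulr_ge0 ?powR_ge0 ?sqr_ge0.
  - by apply: filterS Fg => phi + Sphi => ->.
exists sigma; split=> //; exists g; split=> //.
  have [C CP] := plancherel_continuous_embedding q1p.
  by have [] := CP g Wg (le_lt_trans Eg (ltry _)).
apply/cvgrPdist_le => e e0.
have A0 : 0 <= 2 * (2 * M + 1) + 2 * M.
  by rewrite addr_ge0// mulr_ge0// addr_ge0// mulr_ge0.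
have [j [k0 jk0]] := small_norm q1p e0 A0.
exists (maxn j k0) => // k /=; rewrite geq_max => /andP[jk k0k].
have -> : (fun x => u (sigma k) x - g x) = (fun x => -1 * g x + u (sigma k) x).
  by apply/funext => x; rewrite mulN1r addrC.
rewrite sub0r normrN ger0_norm; last by rewrite /Lp_norm powR_ge0.
apply: (jk0 _ k) => //.
- exact: plancherel_lin.
- exact: energy_sub (uM _).2 Eg.
have := F_lin (-1) Vg (Wu (sigma k)).1 g2 (Wu (sigma k)).2.
apply: filterS3 Fg (hP j k jk) => phi Fg Hh Fl Sphi wj.
by rewrite Fl// Fg// mulN1r addrC; exact: Hh.
Qed.

End Embedding.

End PlancherelSetting.

(** * Boundedness of the spherical transform *)

Lemma cint_le (R : realType) d (T : measurableType d)
    (mu : {measure set T -> \bar R}) (f : T -> R[i]) (g : T -> R) :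
  measurable_fun setT (fun x => complex.Re (f x)) ->
  measurable_fun setT (fun x => complex.Im (f x)) ->
  measurable_fun setT g ->
  (forall x, `|complex.Re (f x)| <= g x) ->
  (forall x, `|complex.Im (f x)| <= g x) ->
  (\int[mu]_x (g x)%:E < +oo)%E ->
  ((cabs (cint mu setT f))%:E <= 2%:E * \int[mu]_x (g x)%:E)%E.
Proof.
move=> mr mi mg rg ig gfin.
have g0 x : 0 <= g x := le_trans (normr_ge0 _) (rg x).
have Ig0 : (0 <= \int[mu]_x (g x)%:E)%E.
  by apply: integral_ge0 => x _; rewrite lee_fin.
have gf : (\int[mu]_x (g x)%:E)%E \is a fin_num by rewrite ge0_fin_numE.
have part (h : T -> R) : measurable_fun setT h -> (forall x, `|h x| <= g x) ->
    (`|Rintegral mu setT h|%:E <= \int[mu]_x (g x)%:E)%E.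
  move=> mh hg.
  have hle : (`|\int[mu]_x (h x)%:E| <= \int[mu]_x (g x)%:E)%E.
    apply: le_trans (le_abse_integral _ _ _) _ => //; first exact/measurable_EFinP.
    by apply: (@le_integral_EFin _ _ _ _ _ _ (fun x => `|h x|)) => //; exact: measurableT_comp.
  (* [fine] sends both infinities to 0, where the bound is trivial. *)
  rewrite /Rintegral; move: hle; case: (\int[mu]_x (h x)%:E)%E => [r| |] //=.
  - by rewrite normr0 => _.
  - by rewrite normr0 => _.
apply: (@le_trans _ _ (`|Rintegral mu setT (fun x => complex.Re (f x))|%:E +
    `|Rintegral mu setT (fun x => complex.Im (f x))|%:E)%E).
  by rewrite -EFinD lee_fin; exact: cabs_le_normReIm.
rewrite -(fineK gf) -EFinM.
have := part _ mr rg; have := part _ mi ig.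
rewrite -(fineK gf) -EFinD !lee_fin; lra.
Qed.

Section Gborel.
Context {R : realType} {G : ptopologicalType}.

Lemma continuous_Gborel_measurable (g : G -> R) :
  (forall x (e : R), 0 < e -> \forall y \near x, `|g y - g x| < e) ->
  measurable_fun [set: Gborel G] (g : Gborel G -> R).
Proof.
move=> gc; apply: (measurability _ (RGenOInfty.measurableE R)) => _ [_ [r ->] <-].
rewrite setTI; apply: sub_sigma_algebra => /=.
rewrite openE => x /=; rewrite in_itv/= andbT => rx.
have : 0 < g x - r by rewrite subr_gt0.
move=> /(gc x); apply: filterS => y /=.
rewrite in_itv/= andbT ltr_norml => /andP[+ _]; lra.
Qed.

Lemma ccontinuous_Gborel_measurable (phi : G -> R[i]) : ccontinuous phi ->
  measurable_fun [set: Gborel G] (fun x : Gborel G => complex.Re (phi x)) /\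
  measurable_fun [set: Gborel G] (fun x : Gborel G => complex.Im (phi x)).
Proof.
move=> pc; split; apply: continuous_Gborel_measurable => x e e0;
  apply: filterS (pc x e e0) => y; apply: le_lt_trans.
- by have := normRe_le_cabs (phi y - phi x); case: (phi y); case: (phi x).
- by have := normIm_le_cabs (phi y - phi x); case: (phi y); case: (phi x).
Qed.

Lemma ccontinuous_comp (phi : G -> R[i]) (inv : G -> G) :
  ccontinuous phi -> continuous inv -> ccontinuous (fun x => phi (inv x)).
Proof. by move=> pc ic x e e0; exact: ic (pc (inv x) e e0). Qed.

End Gborel.

(* Two-point test of positivity with weights [(1, z)], [z = 1, -1, i, -i]. *)
Lemma pos_semidef_bounded (R : realType) (G : ptopologicalType)
    (mul : G -> G -> G) (inv : G -> G) (e : G) (phi : G -> R[i]) (x : G) :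
  is_compact_group mul inv e -> pos_semidef mul inv phi -> phi e = 1 ->
  `|complex.Re (phi x)| <= 1 /\ `|complex.Im (phi x)| <= 1.
Proof.
move=> [[_ _ _ mul1 mulV] _] psd phie.
have inve : inv e = e by have := (mulV e).1; rewrite (mul1 _).2.
have H (z : R[i]) : 0 <= 1 + phi x * z + (phi (inv x) * conjc z + conjc z * z).
  have := psd 2%N (fun i => if i == ord0 then e else x)
                  (fun i => if i == ord0 then 1 else z).
  rewrite !big_ord_recl !big_ord0 /= !addr0 inve (mulV x).1 !(mul1 _).1 (mul1 _).2.
  have -> : Complex (1 : R) (- 0) = 1 by rewrite oppr0.
  by rewrite phie !mulr1 !mul1r.
(* In [R[i]], [0 <= z] also makes the imaginary part vanish: phi(x^-1) is the conjugate of phi(x),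
   and the real parts read 2 +- 2a >= 0 and 2 +- 2b >= 0 for phi(x) = a + i b. *)
have := H 1; have := H (-1); have := H (Complex 0 1); have := H (Complex 0 (-1)).
case: (phi x) => a b; case: (phi (inv x)) => a' b'.
rewrite !lecE /= !ler_norml => /andP[/eqP + +] /andP[/eqP + +] /andP[/eqP + +] /andP[/eqP + +].
by move=> *; split; apply/andP; split; lra.
Qed.

(** One factor 2 comes from multiplying by [phi], whose real and imaginary parts are bounded by 1,
    the other from [cint_le]. This 4 is the origin of the 8 and the 16 above. *)
Lemma sph_transform_bound (R : realType) (G : ptopologicalType)
    (inv : G -> G) (mu : {measure set Gborel G -> \bar R}) (f phi : G -> R[i]) :
  continuous inv -> ccontinuous phi ->
  (forall x, `|complex.Re (phi x)| <= 1 /\ `|complex.Im (phi x)| <= 1) ->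
  in_Lp mu setT 1 f ->
  ((cabs (sph_transform inv mu f phi))%:E <=
   4%:E * \int[mu]_x (cabs (f x))%:E)%E.
Proof.
move=> ic pc p1 [fr fi If].
have [pr pi] := ccontinuous_Gborel_measurable (ccontinuous_comp pc ic).
have mf := measurable_cabs fr fi.
have nn (x : Gborel G) : setT x -> 0 <= cabs (f x) by move=> _; exact: cabs_ge0.
have I2 : (\int[mu]_x (2 * cabs (f x))%:E = 2%:E * \int[mu]_x (cabs (f x))%:E)%E.
  exact: (integral_EFinZ mu measurableT (ler0n _ 2) mf nn).
have Ifin : (\int[mu]_x (cabs (f x))%:E < +oo)%E.
  move: If; rewrite (eq_integral (fun x : Gborel G => (cabs (f x))%:E))// => x _.
  by rewrite powRr1// cabs_ge0.
have bnd (a b c d : R) (t : R) : `|a| <= t -> `|b| <= t -> `|c| <= 1 -> `|d| <= 1 ->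
    `|a * c| + `|b * d| <= 2 * t.
  move=> a1 b1 c1 d1; rewrite !normrM.
  have := ler_pM (normr_ge0 a) (normr_ge0 c) a1 c1.
  have := ler_pM (normr_ge0 b) (normr_ge0 d) b1 d1; lra.
have -> : 4%:E = (2%:E * 2%:E)%E :> \bar R by rewrite -EFinM -natrM.
rewrite -muleA -I2; apply: cint_le => //.
- under eq_fun do rewrite complexReM.
  by apply: measurable_funB; exact: measurable_funM.
- under eq_fun do rewrite complexImM.
  by apply: measurable_funD; exact: measurable_funM.
- exact: measurable_funM.
- move=> x; rewrite complexReM; apply: le_trans (ler_normB _ _) _.
  by apply: bnd; rewrite ?normRe_le_cabs ?normIm_le_cabs// ?(p1 _).1 ?(p1 _).2.
- move=> x; rewrite complexImM; apply: le_trans (ler_normD _ _) _.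
  by apply: bnd; rewrite ?normRe_le_cabs ?normIm_le_cabs// ?(p1 _).1 ?(p1 _).2.
- by rewrite I2 lte_mul_pinfty// lee_fin.
Qed.

(** S^+ is open in itself, hence one of the generators. *)
Lemma measurable_Splus (R : realType) (G : ptopologicalType)
    (mul : G -> G -> G) (inv : G -> G) (nu : {measure set Gborel G -> \bar R}) :
  measurable (Splus mul inv nu : set (Smeas mul inv nu)).
Proof.
apply: sub_sigma_algebra; split=> // phi Sphi.
by exists 1; split.
Qed.

(** * The embedding theorem for Gelfand pairs *)

Unset Implicit Arguments.
Set Strict Implicit.

Theorem theorem3p10
  (R : realType) (G : ptopologicalType)
  (mul : G -> G -> G) (inv : G -> G) (e : G)
  (HG : is_compact_group mul inv e)
  (mu : {measure set Gborel G -> \bar R}) (Hmu : is_haar mul mu)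
  (K : set G) (HK : closed_subgroup mul inv e K)
  (nu : {measure set Gborel G -> \bar R}) (Hnu : is_haar_sub mul K nu)
  (Hgelfand : gelfand_pair mul inv K mu)
  (muh : {measure set Smeas mul inv nu -> \bar R})
  (F : (G -> R[i]) -> Smeas mul inv nu -> R[i])
  (Hplanch : is_plancherel K mu muh F)
  (gamma : Smeas mul inv nu -> R)
  (Hgamma_meas : measurable_fun (Splus mul inv nu : set (Smeas mul inv nu)) gamma)
  (Hgamma_ge0 : forall phi, Splus mul inv nu phi -> 0 <= gamma phi)
  (alpha s : R) (Hs : 0 < s) (Hsalpha : s < alpha)
  (Hint : (\int[muh]_(phi in (Splus mul inv nu : set (Smeas mul inv nu)))
             (((1 + gamma phi ^+ 2)^-1) `^ alpha)%:E < +oo)%E)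
  (Hlim : forall eps : R, 0 < eps ->
     \forall y \near e, forall phi : G -> R[i], Splus mul inv nu phi ->
        cabs (phi y - 1) <= eps * (1 + gamma phi ^+ 2) `^ (s / 2)) :
  forall q : R, 1 <= q <= exp_p' alpha s ->
    (* continuous embedding H^s_gamma -> L^q *)
    (exists C : R, forall f : G -> R[i], in_Hs K mu muh F gamma s f ->
       in_Lp mu setT q f /\
       Lp_norm mu setT q f <= C * Hs_norm muh F gamma s f) /\
    (* bounded subsets of H^s_gamma are relatively compact in L^q(K\G/K) *)
    (forall (u : nat -> G -> R[i]) (M : R),
       (forall n, in_Hs K mu muh F gamma s (u n) /\
                  Hs_norm muh F gamma s (u n) <= M) ->
       exists sigma : nat -> nat, (forall n, (sigma n < sigma n.+1)%N) /\
       exists g : G -> R[i], [/\ biK mul K g, in_Lp mu setT q g &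
         (fun n => Lp_norm mu setT q (fun x => u (sigma n) x - g x))
            @ \oo --> (0 : R)]).
Proof.
set S : set (Smeas mul inv nu) := Splus mul inv nu.
have [mu1 _ _] := Hmu.
have [_ [_ inv_cont]] := HG.
have [_ [_ Fsph Fisom Flin Fsurj]] := Hplanch.
pose w (phi : Smeas mul inv nu) : R := 1 + gamma phi ^+ 2.
have w1 phi : S phi -> 1 <= w phi by move=> _; rewrite lerDl sqr_ge0.
have phie (phi : G -> R[i]) : Splus mul inv nu phi -> phi e = 1.
  move=> Sphi.
  (* A neighbourhood of [e] contains [e]; with [eps] equal to [t] divided by the weight of [phi],
     the bound at [e] becomes the arbitrary [t]. *)
  have le0 : cabs (phi e - 1) <= 0.
    apply/ler_addgt0Pr => t t0; rewrite add0r.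
    have w0 : 0 < (1 + gamma phi ^+ 2) `^ (s / 2).
      by apply: powR_gt0; exact: lt_le_trans (w1 phi Sphi).
    have := nbhs_singleton (Hlim (t / (1 + gamma phi ^+ 2) `^ (s / 2)) (divr_gt0 t0 w0)).
    by move=> /(_ phi Sphi); rewrite divfK ?gt_eqF.
  have /cabs_eq0/eqP : cabs (phi e - 1) = 0.
    by apply/eqP; rewrite eq_le le0 cabs_ge0.
  by rewrite subr_eq0 => /eqP.
have mS : measurable S by exact: measurable_Splus.
have mw : measurable_fun S w.
  by apply: measurable_funD => //; exact: measurable_funX.
have Vcomp (t : R[i] -> R[i]) f : biK mul K f -> biK mul K (fun x => t (f x)).
  by move=> bf k1 k2 x K1 K2; rewrite bf.
have Vlin (a : R[i]) f g : biK mul K f -> biK mul K g ->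
    biK mul K (fun x => a * f x + g x).
  by move=> bf bg k1 k2 x K1 K2; rewrite bf// bg.
have Fbound f : biK mul K f -> in_Lp mu setT 1 f -> in_Lp mu setT 2 f ->
    {ae muh, forall phi, S phi ->
      ((cabs (F f phi))%:E <= 4%:E * \int[mu]_x (cabs (f x))%:E)%E}.
  move=> bf f1 f2; apply: filterS (Fsph f bf f1 f2) => phi Ef Sphi.
  rewrite Ef//; have [[_ pc _] psd] := Sphi.
  apply: sph_transform_bound => // x.
  exact: pos_semidef_bounded HG psd (phie _ Sphi).
have Iw : (\int[muh]_(phi in S) (w phi `^ (- alpha))%:E < +oo)%E.
  move: Hint; rewrite (eq_integral (fun phi => (w phi `^ (- alpha))%:E))//.
  move=> phi; rewrite inE => Sphi.
  rewrite -powR_inv1; last exact: le_trans (w1 _ Sphi).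
  by rewrite -powRrM mulN1r.
move=> q; have -> : exp_p' alpha s = 2 * alpha / (alpha - s).
  rewrite /exp_p' /exp_p; field.
  by rewrite !gt_eqF ?subr_gt0 ?addr_gt0//; lra.
move=> q1p; split.
  have [C CP] := plancherel_continuous_embedding mS mu1 Vcomp Vlin Fbound Fisom
    Flin Fsurj Hs Hsalpha mw w1 Iw q1p.
  by exists C => f [bf f2 fe]; exact: CP.
move=> u M uM.
apply: (plancherel_compact_embedding mS mu1 Vcomp Vlin Fbound Fisom
  Flin Fsurj Hs Hsalpha mw w1 Iw (M := M ^+ 2) q1p) => n.
have [[bu u2 ue] uM'] := uM n; split=> //.
have e0 : (0 <= \int[muh]_(phi in S) (w phi `^ s * cabs (F (u n) phi) ^+ 2)%:E)%E.
  by apply: integral_ge0 => phi _; rewrite lee_fin mulr_ge0 ?powR_ge0 ?sqr_ge0.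
(* [Hs_norm] is read through [fine]; membership in the Sobolev space makes the energy finite, so a
   norm bound [M] is an energy bound [M ^+ 2]. *)
rewrite -[leLHS]fineK ?ge0_fin_numE// lee_fin.
move: uM'; rewrite /Hs_norm /Rintegral -/S; set I := fine _ => IM.
have I0 : 0 <= I by exact: fine_ge0.
have -> : I = (I `^ 2^-1) ^+ 2.
  by rewrite -powR_mulrn ?powR_ge0// -powRrM mulVf ?pnatr_eq0// powRr1.
have M0 : 0 <= M := le_trans (powR_ge0 _ _) IM.
by rewrite ler_pXn2r ?nnegrE ?powR_ge0.
Qed.
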